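(* Fix $\tau\in(0,1)$ and an integer $r\ge1$. Let $y_1,\dots,y_n$ be independent random variables satisfying Assumption A, let $\theta^*\in\mathbb{R}^n$ be the vector of their $\tau$-quantiles, and suppose that $V^*=\mathrm{TV}^{(r)}(\theta^* )=\Theta(1)$. Given any $\epsilon\in(0,1)$ there exists a positive constant $c_{1,\epsilon}$, depending only on $\epsilon$ and $V^*$, such that if $$\lambda=c\,n^{1/(2r+1)}(\log n)^{1/(2r+1)}$$ for a constant $c>c_{1,\epsilon}$, then the penalized quantile trend filtering estimator $$\hat\theta^{(r)}_\lambda\in\arg\min_{\theta\in\mathbb{R}^n}\left\{\sum_{i=1}^n\rho_\tau(y_i-\theta_i)+\lambda\,\mathrm{TV}^{(r)}(\theta)\right\}$$ satisfies $$\Delta_n^2\big(\hat\theta^{(r)}_\lambda-\theta^*\big)\le c_{2,\epsilon}\,n^{-2r/(2r+1)}(\log n)^{1/(2r+1)}$$ with probability at least $1-\epsilon$, where $c_{2,\epsilon}>0$ is a constant that depends only on $c$, $\epsilon$ and $V^*$.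
   Context: Check loss: $\rho_\tau(x)=\max\{\tau x,(\tau-1)x\}$. Quantile vector: $\theta_i^*=\arg\min_{a\in\mathbb{R}}E\{\rho_\tau(y_i-a)\}$ (if $y_i$ has no first moment, this is understood through the always finite differences $E\{\rho_\tau(y_i-a)-\rho_\tau(y_i-b)\}$). Discrete differences: $D^{(0)}(\theta)=\theta$, $D^{(1)}(\theta)=(\theta_2-\theta_1,\dots,\theta_n-\theta_{n-1})^\top$, $D^{(r)}(\theta)=D^{(1)}(D^{(r-1)}(\theta))\in\mathbb{R}^{n-r}$. $\mathrm{TV}^{(r)}(\theta)=n^{r-1}\|D^{(r)}(\theta)\|_1$. Loss: $\Delta_n^2(v)=\frac1n\sum_{i=1}^n\min\{|v_i|,v_i^2\}$ for $v\in\mathbb{R}^n$. Assumption A: there exist constants $L>0$ and $\underline f>0$ such that for every positive integer $n$ and every $\delta\in\mathbb{R}^n$ with $\|\delta\|_\infty\le L$, $|F_{y_i}(\theta_i^*+\delta_i)-F_{y_i}(\theta_i^* )|\ge\underline f|\delta_i|$ for all $i=1,\dots,n$, where $F_{y_i}$ is the CDF of $y_i$. (The distributions of $y_1,\dots,y_n$, and hence $\theta^*$ and $V^*$, may vary with $n$; $L$ and $\underline f$ do not. The quantities $\tau,r,L,\underline f$ are regarded as fixed, and constants may depend on them.) $a_n=\Theta(b_n)$ means that $a_n=O(b_n)$ and $b_n=O(a_n)$ for positive sequences; $V^*=\Theta(1)$ means $V^*$ is bounded above and bounded away from $0$ as $n$ grows.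
   Formalization: The formal theorem additionally assumes F_{y_i}(θ_i^* ) = τ for every i (the claim can fail if y_i has an atom at θ_i^* ), and asserts the bound for all n ≥ n_0, where n_0 depends only on c, ε, V^* and the fixed τ, r, L, f. *)

(* Defs.v *)
From HB Require Import structures.
From mathcomp Require Import all_boot all_order all_algebra.
From mathcomp Require Import all_classical all_reals all_analysis.
Import Order.TTheory GRing.Theory Num.Theory.
Import numFieldNormedType.Exports.

Set Implicit Arguments.
Unset Strict Implicit.
Unset Printing Implicit Defensive.

Local Open Scope classical_set_scope.
Local Open Scope ring_scope.

Definition check_loss (R : realType) (tau x : R) : R :=
  Num.max (tau * x) ((tau - 1) * x).

Lemma ltn_pred_succ (n : nat) (i : 'I_n.-1) : (i.+1 < n)%N.
Proof. by case: n i => [[]|n] //= i; rewrite ltnS ltn_ord. Qed.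

Definition first_diff (R : realType) (n : nat) (v : 'rV[R]_n) : 'rV[R]_n.-1 :=
  \row_(i < n.-1)
    (v 0 (Ordinal (ltn_pred_succ i)) - v 0 (widen_ord (leq_pred n) i)).

(* The dimension iter r predn n equals n - r (lemma iter_predn); it is written
   in this form so that the recursion is well typed without casts.            *)
Fixpoint discrete_diff (R : realType) (r n : nat) (v : 'rV[R]_n) :
    'rV[R]_(iter r predn n) :=
  match r return 'rV[R]_(iter r predn n) with
  | 0 => v
  | r'.+1 => first_diff (discrete_diff r' v)
  end.

Definition trend_variation (R : realType) (r n : nat) (v : 'rV[R]_n) : R :=
  n%:R ^+ r.-1 * \sum_(j < iter r predn n) `|discrete_diff r v 0 j|.

(* This is the squared quantity, Delta_n^2. *)
Definition delta_sq (R : realType) (n : nat) (v : 'rV[R]_n) : R :=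
  n%:R^-1 * \sum_(i < n) Num.min `|v 0 i| (v 0 i ^+ 2).

Definition qtf_objective (R : realType) (tau : R) (r n : nat) (lambda : R)
    (y theta : 'rV[R]_n) : R :=
  \sum_(i < n) check_loss tau (y 0 i - theta 0 i)
    + lambda * trend_variation r theta.

Section random_vectors.
Context (d : measure_display) (T : measurableType d) (R : realType)
        (P : probability T R).

Definition random_row (n : nat) (X : 'I_n -> {RV P >-> R}) (w : T) :
    'rV[R]_n :=
  \row_(i < n) X i w.

(* Subfamilies are covered by taking B i = setT. *)
Definition mutually_independent (n : nat) (X : 'I_n -> {RV P >-> R}) : Prop :=
  forall B : 'I_n -> set R, (forall i, measurable (B i)) ->
    P (\bigcap_(i in [set: 'I_n]) (X i @^-1` B i)) =
    (\prod_(i < n) P (X i @^-1` B i))%E.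

(* a minimizes the expected check loss of X; the expectation of the difference
   of losses is finite for every X, as this difference is bounded.            *)
Definition minimizes_expected_check_loss (tau : R) (X : {RV P >-> R}) (a : R) :
    Prop :=
  forall b : R,
    ('E_P[fun w =>
         (check_loss tau (X w - a) - check_loss tau (X w - b))%R] <= 0)%E.

Definition cdf_growth (n : nat) (y : 'I_n -> {RV P >-> R}) (theta : 'rV[R]_n)
    (L f : R) : Prop :=
  forall delta : 'rV[R]_n, (forall j, `|delta 0 j| <= L) ->
    forall i : 'I_n,
      ((f * `|delta 0 i|)%:E <=
       `|cdf (y i) (theta 0%R i + delta 0%R i)%R - cdf (y i) (theta 0%R i)|)%E.

Definition is_qtf_estimator (tau : R) (r n : nat) (lambda : R)
    (y theta_hat : 'I_n -> {RV P >-> R}) : Prop :=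
  forall (w : T) (theta : 'rV[R]_n),
    qtf_objective tau r lambda (random_row y w) (random_row theta_hat w) <=
    qtf_objective tau r lambda (random_row y w) theta.

End random_vectors.

(* Main.v *)
(* Write v for the estimation error, rho for the check loss, and let
   X = (n log n)^(1/(2r+1)), so that lambda = c X.

   If the Huber-type loss of v is too large, convexity shrinks v to a vector v'
   with c0 * sum_i min(|v'_i|, v'_i^2) + lambda TV(v') = 4 lambda V that still
   does not increase the objective. Assumption A bounds the expected excess
   check loss below by c0 * sum_i min(|v'_i|, v'_i^2), so the centred empirical
   process at v' is at least lambda V up to rounding. By Markov's inequality it
   remains to bound the expected supremum of this process by eps lambda V.

   Replacing the data by a finite discretization turns all expectations into
   finite sums. Coordinate by coordinate, the process is then dominated by the
   Rademacher process sum_i e_i v_i, because the difference of two check losses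
   is 1-Lipschitz. Cut {1, ..., n} into about X blocks of length l. Taylor
   expansion on each block writes v as a piecewise polynomial plus a combination
   of n - r atoms with coefficients D^(r) v and norms at most l^(r-1/2). The
   projection of e on the piecewise polynomials has expected squared norm at
   most a multiple of X; the remaining part contributes at most TV(v) times the
   maximum of n - r subgaussian variables, of order X in expectation. Both are
   small compared with lambda = c X when c is large. *)
Require Import Defs.
From HB Require Import structures.
From mathcomp Require Import all_boot all_order all_algebra.
From mathcomp Require Import all_classical all_reals all_analysis.
From mathcomp Require Import measurable_realfun zify ring lra.
Import Order.TTheory GRing.Theory Num.Theory.
Import numFieldNormedType.Exports.

Set Implicit Arguments.
Unset Strict Implicit.
Unset Printing Implicit Defensive.

Local Open Scope classical_set_scope.
Local Open Scope ring_scope.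

(** * Symmetrization and contraction over finite product spaces *)

(** A plain finite sum over configurations. That [p] consists of probabilities is a separate
    condition, [pmf_family], since linearity holds for any weights. *)
Definition Eprod (R : realFieldType) (I K : finType) (p : I -> K -> R)
    (F : {ffun I -> K} -> R) : R :=
  \sum_(k : {ffun I -> K}) (\prod_i p i (k i)) * F k.

Definition pmf_family (R : realFieldType) (I K : finType) (p : I -> K -> R) :=
  (forall i k, 0 <= p i k) /\ (forall i, \sum_k p i k = 1).

Definition upd (I K : finType) (k : {ffun I -> K}) (i : I) (x : K) :
    {ffun I -> K} :=
  [ffun j => if j == i then x else k j].

Definition rademacher (R : realFieldType) (I : finType) (_ : I) (_ : bool) : R
  := 2^-1.

Definition sgn (R : realFieldType) (b : bool) : R := if b then 1 else -1.

(** The maximum is encoded as the value at a maximizer, with [s0] witnessing that [S] is nonempty.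
    Unfolding it yields an actual maximizer, as [fmax_contract] requires. *)
Definition fmax (R : realFieldType) (S : finType) (s0 : S) (F : S -> R) : R :=
  F [arg max_(s > s0) F s]%O.

Lemma upd_eq (I K : finType) (k : {ffun I -> K}) i x : upd k i x i = x.
Proof. by rewrite ffunE eqxx. Qed.

Lemma upd_neq (I K : finType) (k : {ffun I -> K}) i x j :
  j != i -> upd k i x j = k j.
Proof. by rewrite ffunE => /negPf ->. Qed.

Lemma Eprod_sum1 (R : realFieldType) (I K : finType) (p : I -> K -> R) :
  pmf_family p -> \sum_(k : {ffun I -> K}) \prod_i p i (k i) = 1.
Proof.
by case=> _ p1; rewrite -(bigA_distr_bigA p) big1.
Qed.

Lemma Eprod_const (R : realFieldType) (I K : finType) (p : I -> K -> R) c :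
  pmf_family p -> Eprod p (fun=> c) = c.
Proof. by move=> pp; rewrite /Eprod -mulr_suml Eprod_sum1 // mul1r. Qed.

Lemma eq_Eprod (R : realFieldType) (I K : finType) (p : I -> K -> R) F G :
  F =1 G -> Eprod p F = Eprod p G.
Proof. by move=> FG; apply: eq_bigr => k _; rewrite FG. Qed.

Lemma le_Eprod (R : realFieldType) (I K : finType) (p : I -> K -> R) F G :
  pmf_family p -> (forall k, F k <= G k) -> Eprod p F <= Eprod p G.
Proof.
move=> [p0 _] FG; apply: ler_sum => k _; apply: ler_wpM2l => //.
by apply: prodr_ge0.
Qed.

Lemma EprodD (R : realFieldType) (I K : finType) (p : I -> K -> R) F G :
  Eprod p (fun k => F k + G k) = Eprod p F + Eprod p G.
Proof.
by rewrite /Eprod -big_split; apply: eq_bigr => k _; rewrite mulrDr.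
Qed.

Lemma EprodZ (R : realFieldType) (I K : finType) (p : I -> K -> R) c F :
  Eprod p (fun k => c * F k) = c * Eprod p F.
Proof.
by rewrite /Eprod mulr_sumr; apply: eq_bigr => k _; rewrite mulrCA.
Qed.

Lemma Eprod_sum (R : realFieldType) (I K : finType) (p : I -> K -> R)
    (J : Type) (r : seq J) (Q : pred J) F :
  Eprod p (fun k => \sum_(j <- r | Q j) F j k)
  = \sum_(j <- r | Q j) Eprod p (F j).
Proof.
rewrite /Eprod exchange_big /=; apply: eq_bigr => k _.
by rewrite mulr_sumr.
Qed.

Lemma Eprod_prod (R : realFieldType) (I K : finType) (p g : I -> K -> R) :
  Eprod p (fun k => \prod_i g i (k i)) = \prod_i \sum_x p i x * g i x.
Proof.
rewrite (bigA_distr_bigA (fun i x => p i x * g i x)).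
by apply: eq_bigr => k _; rewrite big_split.
Qed.

(* The swap (k, x) |-> (k with k i := x, k i) is an involution that preserves
   the product weight. *)
Lemma Eprod_resample (R : realFieldType) (I K : finType) (p : I -> K -> R) i F :
  pmf_family p ->
  Eprod p F = Eprod p (fun k => \sum_x p i x * F (upd k i x)).
Proof.
move=> [p0 p1]; rewrite /Eprod.
have -> : \sum_(k : {ffun I -> K}) (\prod_j p j (k j)) * F k =
   \sum_(z : {ffun I -> K} * K) (\prod_j p j (z.1 j)) * p i z.2 * F z.1.
  rewrite -(pair_bigA _ (fun (k : {ffun I -> K}) x =>
    (\prod_j p j (k j)) * p i x * F k)) /=.
  apply: eq_bigr => k _; rewrite -mulr_suml -mulr_sumr p1 mulr1 //.
under [RHS]eq_bigr => k _ do rewrite mulr_sumr.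
rewrite pair_bigA /=.
pose h (z : {ffun I -> K} * K) : {ffun I -> K} * K := (upd z.1 i z.2, z.1 i).
have hK : involutive h.
  case=> k x; rewrite /h /= upd_eq; congr pair.
  by apply/ffunP => j; rewrite !ffunE; case: eqP => // ->.
rewrite (reindex_inj (can_inj hK)) /=; apply: eq_bigr => -[k x] _ /=.
rewrite mulrA; congr (_ * _).
rewrite (bigD1 i) //= [in RHS](bigD1 i) //= upd_eq.
rewrite (eq_bigr (fun j => p j (k j))); first by ring.
by move=> j ji; rewrite upd_neq.
Qed.

Lemma rademacher_pmf (R : realFieldType) (I : finType) :
  pmf_family (@rademacher R I).
Proof.
split=> [i k|i]; first by rewrite /rademacher; lra.
by rewrite /index_enum; rewrite big_bool /rademacher /=; lra.
Qed.

Lemma fmax_ge (R : realFieldType) (S : finType) (s0 : S) (F : S -> R) s :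
  F s <= fmax s0 F.
Proof. by rewrite /fmax; case: arg_maxP => // i _ /(_ s); apply. Qed.

Lemma fmax_le (R : realFieldType) (S : finType) (s0 : S) (F : S -> R) c :
  (forall s, F s <= c) -> fmax s0 F <= c.
Proof. by move=> Fc; apply: Fc. Qed.

Lemma eq_fmax (R : realFieldType) (S : finType) (s0 : S) (F G : S -> R) :
  F =1 G -> fmax s0 F = fmax s0 G.
Proof.
move=> FG; apply/le_anti/andP; split; apply: fmax_le => s.
  by rewrite FG fmax_ge.
by rewrite -FG fmax_ge.
Qed.

(** With maximizers [s] and [t], the left side is [A s + A t + (h s - h t)]. The sign of [x s - x t]
    decides which of the two maxima on the right is evaluated at [s] and which at [t]. *)
Lemma fmax_contract (R : realFieldType) (S : finType) (s0 : S)
    (A h x : S -> R) :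
  (forall s t, h s - h t <= `|x s - x t|) ->
  fmax s0 (fun s => A s + h s) + fmax s0 (fun s => A s - h s) <=
  fmax s0 (fun s => A s + x s) + fmax s0 (fun s => A s - x s).
Proof.
move=> hx; rewrite {1 2}/fmax.
set s := [arg max_(s > s0) (A s + h s)]%O.
set t := [arg max_(s > s0) (A s - h s)]%O.
have := hx s t.
have := fmax_ge s0 (fun s => A s + x s) s.
have := fmax_ge s0 (fun s => A s - x s) s.
have := fmax_ge s0 (fun s => A s + x s) t.
have := fmax_ge s0 (fun s => A s - x s) t.
by case: (ler0P (x s - x t)) => _ /=; lra.
Qed.

(** The index [l] of the centring sum is an independent copy of [k]; convexity of the maximum moves
    the average over [l] outside. Exchanging the two copies pairs [M k l] with [M l k], and
    [fmax_contract] bounds the pair. *)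
Lemma fmax_symmetrize (R : realFieldType) (S K : finType) (s0 : S) (q : K -> R)
    (A x : S -> R) (g : K -> S -> R) :
  (forall k, 0 <= q k) -> \sum_k q k = 1 ->
  (forall k l s t, (g l s - g k s) - (g l t - g k t) <= `|x s - x t|) ->
  \sum_k q k * fmax s0 (fun s => A s + ((\sum_l q l * g l s) - g k s)) <=
  2^-1 * (fmax s0 (fun s => A s + x s) + fmax s0 (fun s => A s - x s)).
Proof.
move=> q0 q1 gx.
set C := (X in _ <= _ * X).
pose M k l := fmax s0 (fun s => A s + (g l s - g k s)).
have MC k l : M k l + M l k <= C.
  have -> : M l k = fmax s0 (fun s => A s - (g l s - g k s)).
    by apply: eq_fmax => s; ring.
  exact: fmax_contract.
have le1 k : fmax s0 (fun s => A s + ((\sum_l q l * g l s) - g k s)) <=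
             \sum_l q l * M k l.
  apply: fmax_le => s.
  have -> : A s + ((\sum_l q l * g l s) - g k s) =
            \sum_l q l * (A s + (g l s - g k s)).
    rewrite [RHS](eq_bigr (fun l => q l * (A s - g k s) + q l * g l s));
      last by move=> l _; ring.
    by rewrite big_split /= -mulr_suml q1; ring.
  by apply: ler_sum => l _; apply: ler_wpM2l => //; exact: fmax_ge.
apply: (@le_trans _ _ (\sum_k \sum_l q k * q l * M k l)).
  apply: ler_sum => k _; under eq_bigr => l _ do rewrite -mulrA.
  by rewrite -mulr_sumr ler_wpM2l.
have -> : \sum_k \sum_l q k * q l * M k l =
   2^-1 * \sum_k \sum_l q k * q l * (M k l + M l k).
  under [in RHS]eq_bigr => k _ do
    (under eq_bigr => l _ do rewrite mulrDr; rewrite big_split /=).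
  rewrite big_split /= [X in _ + X]exchange_big /=.
  under [X in _ + X]eq_bigr => k _ do
    under eq_bigr => l _ do rewrite (mulrC (q l)).
  by lra.
rewrite ler_wpM2l ?invr_ge0 //.
apply: (@le_trans _ _ (\sum_k \sum_l q k * q l * C)).
  by apply: ler_sum => k _; apply: ler_sum => l _; rewrite ler_wpM2l // mulr_ge0.
under eq_bigr => k _ do (rewrite -mulr_suml -mulr_sumr q1 mulr1).
by rewrite -mulr_suml q1 mul1r.
Qed.

(* The coordinates are exchanged for Rademacher signs one at a time. *)
Lemma symmetrization_contraction (R : realFieldType) (S K : finType) (n : nat)
    (s0 : S) (p : 'I_n -> K -> R) (phi : 'I_n -> K -> S -> R)
    (x : 'I_n -> S -> R) :
  pmf_family p ->
  (forall i k l s t, (phi i l s - phi i k s) - (phi i l t - phi i k t) <=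
                     `|x i s - x i t|) ->
  Eprod p (fun k => fmax s0 (fun s =>
     \sum_i ((\sum_l p i l * phi i l s) - phi i (k i) s))) <=
  Eprod (@rademacher R _) (fun e => fmax s0 (fun s => \sum_i sgn R (e i) * x i s)).
Proof.
move=> pp hx; have rr := rademacher_pmf R 'I_n.
pose psi i (k : K) s := (\sum_l p i l * phi i l s) - phi i k s.
(* Hybrid process: coordinates below [m] already carry signs, the others still carry centred
   data. *)
pose term m (k : {ffun 'I_n -> K}) (e : {ffun 'I_n -> bool}) (i : 'I_n) s :=
  if (i < m)%N then sgn R (e i) * x i s else psi i (k i) s.
pose H m := Eprod p (fun k => Eprod (@rademacher R _) (fun e =>
   fmax s0 (fun s => \sum_i term m k e i s))).
suff step m : (m < n)%N -> H m <= H m.+1.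
  have : H 0%N <= H n.
    have : forall m, (m <= n)%N -> H 0%N <= H m.
      elim=> // m IH mn; apply: le_trans (step _ mn); apply: IH; exact: ltnW.
    by apply.
  have -> : H 0%N = Eprod p (fun k => fmax s0 (fun s =>
     \sum_i ((\sum_l p i l * phi i l s) - phi i (k i) s))).
    apply: eq_Eprod => k; rewrite -[RHS](Eprod_const _ rr).
    by apply: eq_Eprod => e; apply: eq_fmax => s; apply: eq_bigr.
  move=> /le_trans; apply.
  rewrite le_eqVlt; apply/orP; left; apply/eqP.
  rewrite /H; rewrite [LHS](_ : _ = Eprod p (fun=>
    Eprod (@rademacher R _) (fun e => fmax s0 (fun s => \sum_i sgn R (e i) * x i s)))).
    by rewrite Eprod_const.
  apply: eq_Eprod => k; apply: eq_Eprod => e; apply: eq_fmax => s.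
  by apply: eq_bigr => i _; rewrite /term ltn_ord.
move=> mn; pose j := Ordinal mn.
pose A k e s := \sum_(i | i != j) term m k e i s.
have psiA k e l : (fun s => \sum_i term m (upd k j l) e i s) =1
    (fun s => A k e s + psi j l s).
  move=> s; rewrite (bigD1 j) //= {1}/term ltnn upd_eq addrC; congr (_ + _).
  by apply: eq_bigr => i ij; rewrite /term upd_neq.
have radA k e b : (fun s => \sum_i term m.+1 k (upd e j b) i s) =1
    (fun s => A k e s + sgn R b * x j s).
  move=> s; rewrite (bigD1 j) //= {1}/term /= ltnSn upd_eq addrC; congr (_ + _).
  apply: eq_bigr => i ij; rewrite /term upd_neq //.
  by rewrite ltnS leq_eqVlt -[(i == m :> nat)]/(i == j) (negPf ij).
(* Both sides are averaged over coordinate [j] alone, the datum on the left and the sign on the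
   right; everything else is frozen in [A]. *)
rewrite /H (Eprod_resample j) //.
apply: le_Eprod => // k; under eq_bigr => l _ do rewrite -EprodZ.
rewrite -Eprod_sum [leRHS](Eprod_resample j) //; apply: le_Eprod => // e.
under eq_bigr => l _ do rewrite (eq_fmax _ (psiA _ _ _)).
under [leRHS]eq_bigr => b _ do rewrite (eq_fmax _ (radA _ _ _)).
rewrite big_bool /rademacher /= -mulrDr.
apply: le_trans (fmax_symmetrize s0 _ _ _ _) _.
- by move=> ?; apply: pp.1.
- exact: pp.2.
- by move=> *; apply: hx.
rewrite ler_wpM2l ?invr_ge0 //; apply: lerD; rewrite le_eqVlt; apply/orP; left.
  by apply/eqP/eq_fmax => s; rewrite mul1r.
by apply/eqP/eq_fmax => s; rewrite mulN1r.
Qed.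

(** * Rademacher width of a subspace plus a convex hull *)

Lemma mulmx_tr_ge0 (R : realFieldType) (n : nat) (u : 'rV[R]_n) :
  0 <= (u *m u^T) 0 0.
Proof. by rewrite mxE sumr_ge0 // => i _; rewrite mxE -expr2 sqr_ge0. Qed.

Lemma mulmx_tr_eq0 (R : realFieldType) (n : nat) (u : 'rV[R]_n) :
  u *m u^T = 0 -> u = 0.
Proof.
move=> /matrixP /(_ 0 0); rewrite !mxE => /eqP.
rewrite psumr_eq0 => [/allP u0|i _]; last by rewrite mxE -expr2 sqr_ge0.
apply/rowP => i; have := u0 i (mem_index_enum _).
by rewrite !mxE -expr2 sqrf_eq0 => /eqP.
Qed.

(* P = B^T (B B^T)^-1 B for a row basis B of A. *)
Lemma orthogonal_projection (R : realFieldType) (k n : nat) (A : 'M[R]_(k, n)) :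
  exists P : 'M[R]_n,
    [/\ P^T = P, P *m P = P, A *m P = A & \tr P <= k%:R].
Proof.
have [q [B [Bfree [C AC] qk]]] : exists q (B : 'M[R]_(q, n)),
    [/\ row_free B, exists C, A = C *m B & (q <= k)%N].
  exists (\rank A), (row_base A); split; first exact: row_base_free.
    by apply/submxP; rewrite eq_row_base.
  exact: rank_leq_row.
pose G := B *m B^T.
(* If [u *m G] vanishes, so does the squared norm of [u *m B], and the rows of [B] are free. *)
have Gu : G \in unitmx.
  rewrite -row_free_unit -kermx_eq0; apply/eqP/row_matrixP => i.
  rewrite row0; set u := row i _.
  have uG : u *m G = 0 by rewrite /u -row_mul mulmx_ker row0.
  have uB : u *m B = 0.
    apply: mulmx_tr_eq0; rewrite trmx_mul mulmxA -(mulmxA u) uG mul0mx //.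
  apply/(row_free_inj Bfree); rewrite mul0mx //.
exists (B^T *m invmx G *m B); split.
- rewrite !trmx_mul trmxK mulmxA trmx_inv; congr (_ *m _ *m _).
  by congr invmx; rewrite /G trmx_mul trmxK.
- rewrite !mulmxA; congr (_ *m _); rewrite -!mulmxA; congr (_ *m _).
  by rewrite (mulmxA B) -/G mulmxV // mulmx1.
- rewrite AC -!mulmxA; congr (_ *m _).
  by rewrite !mulmxA -/G mulmxV // mul1mx.
- by rewrite mxtrace_mulC mulmxA -/G mulmxV // mxtrace1 ler_nat.
Qed.

(** Pythagoras: the squared norm of [u] is the sum of those of [u *m P] and [u - u *m P]. *)
Lemma projection_contract (R : realFieldType) (n : nat) (P : 'M[R]_n)
    (u : 'rV[R]_n) :
  P^T = P -> P *m P = P ->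
  ((u - u *m P) *m (u - u *m P)^T) 0 0 <= (u *m u^T) 0 0.
Proof.
move=> PT PP.
have E : (u - u *m P) *m (u - u *m P)^T = u *m u^T - (u *m P) *m (u *m P)^T.
  rewrite linearB /= !trmx_mul PT mulmxBr !mulmxBl.
  rewrite !mulmxA -(mulmxA u P P) PP.
  by rewrite subrr subr0.
by rewrite E [in leLHS]mxE [X in _ + X]mxE lerBlDr lerDl mulmx_tr_ge0.
Qed.

(** Cauchy-Schwarz in arithmetic-geometric form. Being linear in the quadratic form of [u], the
    bound can be averaged over random signs without a square root. *)
Lemma projection_young (R : realFieldType) (n : nat) (P : 'M[R]_n)
    (u v : 'rV[R]_n) (a : R) : 0 < a ->
  P^T = P -> P *m P = P ->
  (u *m P *m v^T) 0 0 <=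
  2^-1 * (a * (v *m v^T) 0 0 + a^-1 * (u *m P *m u^T) 0 0).
Proof.
move=> a0 PT PP.
have -> : u *m P *m u^T = (u *m P) *m (u *m P)^T.
  by rewrite trmx_mul PT mulmxA -(mulmxA u P P) PP.
move: (u *m P) => p; rewrite !mxE !mulr_sumr -big_split mulr_sumr /=.
apply: ler_sum => i _; rewrite !mxE.
have -> : 2^-1 * (a * (v 0 i * v 0 i) + a^-1 * (p 0 i * p 0 i)) =
  p 0 i * v 0 i + 2^-1 * (a^-1 * (a * v 0 i - p 0 i) ^+ 2).
  by field; rewrite gt_eqF.
by rewrite lerDl mulr_ge0 ?invr_ge0 // mulr_ge0 ?sqr_ge0 // invr_ge0 ltW.
Qed.

Lemma rademacher_cov (R : realFieldType) (n : nat) (i j : 'I_n) :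
  Eprod (@rademacher R _) (fun e => sgn R (e i) * sgn R (e j)) = (i == j)%:R.
Proof.
have rr := rademacher_pmf R 'I_n.
case: (eqVneq i j) => [<-|ij].
  rewrite -[RHS](Eprod_const _ rr); apply: eq_Eprod => e.
  by rewrite /sgn; case: (e i); rewrite ?mulrNN mul1r.
rewrite (Eprod_resample i) // -[RHS](Eprod_const _ rr); apply: eq_Eprod => e.
rewrite big_bool /= !upd_eq !upd_neq 1?eq_sym // /sgn /rademacher.
ring.
Qed.

Definition sgn_row (R : realFieldType) (n : nat) (e : {ffun 'I_n -> bool}) :
  'rV[R]_n := \row_i sgn R (e i).

Lemma rademacher_quad (R : realFieldType) (n : nat) (P : 'M[R]_n) :
  Eprod (@rademacher R _)
    (fun e => (sgn_row R e *m P *m (sgn_row R e)^T) 0 0) = \tr P.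
Proof.
rewrite (@eq_Eprod _ _ _ _ _ (fun e =>
    \sum_j \sum_i P i j * (sgn R (e i) * sgn R (e j)))).
  rewrite Eprod_sum; apply: eq_bigr => j _; rewrite Eprod_sum.
  rewrite (bigD1 j) //= big1 => [|i ij]; last first.
    by rewrite EprodZ rademacher_cov (negPf ij) mulr0.
  by rewrite EprodZ rademacher_cov eqxx mulr1 addr0.
move=> e; rewrite mxE; apply: eq_bigr => j _; rewrite mxE mulr_suml.
by apply: eq_bigr => i _; rewrite !mxE; ring.
Qed.

(** The generous constant 2 keeps the proof elementary: for [x] up to 1/2 it follows from
    [1 + z <= expR z], and beyond that [x <= 2 * x ^+ 2]. *)
Lemma cosh_le (R : realType) (x : R) :
  2^-1 * (expR x + expR (- x)) <= expR (2 * x ^+ 2).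
Proof.
wlog x0 : x / 0 <= x => [H|].
  case: (lerP 0 x) => [/H//|x0]; have := H (- x); rewrite opprK sqrrN addrC.
  by apply; lra.
case: (lerP x 2^-1) => xh.
  have e1 : expR x <= (1 - x)^-1.
    rewrite -[x in expR x]opprK expRN lef_pV2 ?posrE ?expR_gt0 //; last by lra.
    by have := expR_ge1Dx (- x).
  have e2 : expR (- x) <= (1 + x)^-1.
    by rewrite expRN lef_pV2 ?posrE ?expR_gt0 ?expR_ge1Dx //; lra.
  apply: (@le_trans _ _ (1 + 2 * x ^+ 2)); last exact: expR_ge1Dx.
  apply: (@le_trans _ _ (2^-1 * ((1 - x)^-1 + (1 + x)^-1))); first by lra.
  have -> : 2^-1 * ((1 - x)^-1 + (1 + x)^-1) = (1 - x ^+ 2)^-1.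
    rewrite (_ : 1 - x ^+ 2 = (1 - x) * (1 + x)); last by ring.
    by field; rewrite !gt_eqF //; lra.
  have h3 : 0 < 1 - x ^+ 2 by rewrite expr2; nra.
  rewrite -[leLHS]mul1r ler_pdivrMr //.
  have -> : (1 + 2 * x ^+ 2) * (1 - x ^+ 2) = 1 + x ^+ 2 * (1 - 2 * x ^+ 2) by ring.
  rewrite lerDl mulr_ge0 ?sqr_ge0 // expr2; nra.
have h1 : expR (- x) <= expR x by rewrite ler_expR; lra.
apply: (@le_trans _ _ (expR x)); first by lra.
by rewrite ler_expR; nra.
Qed.

Lemma rademacher_mgf (R : realType) (n : nat) (b : 'rV[R]_n) :
  Eprod (@rademacher R _) (fun e => expR (\sum_i sgn R (e i) * b 0 i)) <=
  expR (2 * \sum_i b 0 i ^+ 2).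
Proof.
under eq_Eprod => e do rewrite expR_sum.
rewrite (Eprod_prod _ (fun i x => expR (sgn R x * b 0 i))).
rewrite mulr_sumr expR_sum; apply: ler_prod => i _.
rewrite big_bool /= /rademacher /sgn mul1r mulN1r -mulrDr cosh_le andbT.
by rewrite mulr_ge0 ?addr_ge0 ?expR_ge0 ?invr_ge0.
Qed.

(** Two instances of [1 + z <= expR z]. Summing the exponentials over a family bounds all its
    members at once, and this common bound has an easily computed expectation. *)
Lemma soft_max (R : realType) (s L z : R) : 0 < s ->
  `|z| <= s^-1 * (L + (expR (s * z - L) + expR (- (s * z) - L))).
Proof.
move=> s0; rewrite mulrC ler_pdivlMr //.
have h1 := expR_ge1Dx (s * z - L); have h2 := expR_ge1Dx (- (s * z) - L).
have := expR_ge0 (s * z - L); have := expR_ge0 (- (s * z) - L).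
by case: (ler0P z) => _; lra.
Qed.

(** The sign vector is split by the projection [P] onto the row space of [A]. The projected part is
    controlled by [projection_young] and the trace of [P]; the complement kills [A] and sees only
    the rows of [Q], weighted by [w]. *)
Lemma rademacher_width (R : realType) (S : finType) (s0 : S) (n k N : nat)
    (A : 'M[R]_(k, n)) (Q : 'M[R]_(N, n)) (x : S -> 'rV[R]_n)
    (a W D s beta : R) :
  (0 < N)%N -> 0 < a -> 0 < s -> 0 <= D ->
  (forall j, \sum_i Q j i ^+ 2 <= beta) ->
  (forall t, \sum_i x t 0 i ^+ 2 <= W) ->
  (forall t, exists (c : 'rV[R]_k) (w : 'rV[R]_N),
     x t = c *m A + w *m Q /\ \sum_j `|w 0 j| <= D) ->
  Eprod (@rademacher R _) (fun e => fmax s0 (fun t =>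
      \sum_i sgn R (e i) * x t 0 i)) <=
  2^-1 * (a * W + a^-1 * k%:R) + D * (s^-1 * (ln N%:R + 2 * s ^+ 2 * beta + 2)).
Proof.
move=> N0 a0 sp D0 hQ hW hx; have rr := rademacher_pmf R 'I_n.
have [P [PT PP AP trP]] := orthogonal_projection A.
pose b j : 'rV[R]_n := row j Q - row j Q *m P.
have hb j : \sum_i b j 0 i ^+ 2 <= beta.
  apply: le_trans (hQ j).
  have := projection_contract (row j Q) PT PP; rewrite -/(b j) !mxE.
  under eq_bigr do rewrite [(b j)^T _ _]mxE -expr2.
  by under [leRHS]eq_bigr do rewrite !mxE -expr2.
pose z j (e : {ffun 'I_n -> bool}) := \sum_i sgn R (e i) * b j 0 i.
(* With this [L] each exponential in [M] has expectation at most 1/N, so the 2N of them contribute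
   at most 2. *)
pose L := ln N%:R + 2 * s ^+ 2 * beta.
pose M e := s^-1 * (L + \sum_j (expR (s * z j e - L) + expR (- (s * z j e) - L))).
have zM j e : `|z j e| <= M e.
  apply: le_trans (soft_max L _ sp) _.
  rewrite ler_pM2l ?invr_gt0 // lerD2l (bigD1 j) //= lerDl.
  by apply: sumr_ge0 => l _; rewrite addr_ge0 ?expR_ge0.
have split_e (e : {ffun 'I_n -> bool}) t : \sum_i sgn R (e i) * x t 0 i <=
   2^-1 * (a * W + a^-1 * (sgn_row R e *m P *m (sgn_row R e)^T) 0 0) + D * M e.
  have [c [w [xE wD]]] := hx t.
  set u := sgn_row R e.
  have -> : \sum_i sgn R (e i) * x t 0 i =
     (u *m P *m (x t)^T) 0 0 + \sum_j w 0 j * z j e.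
    have -> : \sum_j w 0 j * z j e = ((x t - x t *m P) *m u^T) 0 0.
      have -> : x t - x t *m P = w *m (Q - Q *m P).
        rewrite xE mulmxDl -!mulmxA AP mulmxBr.
        by rewrite opprD addrACA subrr add0r.
      rewrite -mulmxA mxE; apply: eq_bigr => j _; congr (_ * _).
      rewrite mxE; apply: eq_bigr => i _.
      by rewrite /b -row_mul -linearB /= !mxE mulrC.
    have -> : u *m P *m (x t)^T = (x t *m P *m u^T)^T.
      by rewrite !trmx_mul !trmxK PT mulmxA.
    have sub00 (B C : 'M[R]_1) : B^T 0 0 + (C - B) 0 0 = C 0 0.
      by rewrite !mxE; ring.
    rewrite mulmxBl sub00.
    by rewrite mxE; apply: eq_bigr => i _; rewrite !mxE mulrC.
  apply: lerD.
    apply: le_trans (projection_young u (x t) a0 PT PP) _.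
    rewrite ler_pM2l // lerD2r ler_pM2l //; apply: le_trans (hW t).
    by rewrite mxE; under eq_bigr do rewrite mxE -expr2.
  have M0 : 0 <= M e.
    by have := le_trans (normr_ge0 _) (zM (Ordinal N0) e).
  apply: le_trans (ler_wpM2r M0 wD); rewrite mulr_suml.
  apply: ler_sum => j _; apply: le_trans (ler_norm _) _.
  by rewrite normrM ler_wpM2l.
apply: (@le_trans _ _ (Eprod (@rademacher R _) (fun e =>
  2^-1 * (a * W + a^-1 * (sgn_row R e *m P *m (sgn_row R e)^T) 0 0) + D * M e))).
  by apply: le_Eprod => // e; apply: fmax_le.
rewrite EprodD EprodZ EprodD Eprod_const // EprodZ rademacher_quad EprodZ.
apply: lerD.
  by rewrite ler_pM2l // lerD2l ler_pM2l // invr_gt0.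
rewrite ler_wpM2l // /M EprodZ ler_pM2l ?invr_gt0 // EprodD Eprod_const //.
rewrite -/L lerD2l Eprod_sum.
apply: (@le_trans _ _ (\sum_(j < N) N%:R^-1 * 2)); last first.
  by rewrite sumr_const card_ord -[_ *+ N]mulr_natr mulrAC
    mulVf ?mul1r // pnatr_eq0 -lt0n.
apply: ler_sum => j _.
have mgf (q : R) : q ^+ 2 = s ^+ 2 -> Eprod (@rademacher R _)
    (fun e => expR (q * z j e - L)) <= N%:R^-1.
  move=> qs.
  rewrite (@eq_Eprod _ _ _ _ _ (fun e => expR (- L) *
      expR (\sum_i sgn R (e i) * (q *: b j) 0 i))); last first.
    move=> e; rewrite addrC expRD; congr (_ * expR _).
    by rewrite /z mulr_sumr; apply: eq_bigr => i _; rewrite [in RHS]mxE mulrCA.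
  rewrite EprodZ; apply: le_trans (ler_wpM2l (expR_ge0 _) (rademacher_mgf _)) _.
  rewrite -expRD -[leRHS]lnK ?posrE ?invr_gt0 ?ltr0n //
    ler_expR lnV ?posrE ?ltr0n //.
  rewrite /L; under eq_bigr do rewrite mxE exprMn qs.
  rewrite -mulr_sumr.
  have := ler_wpM2l (sqr_ge0 s) (hb j); lra.
rewrite EprodD.
have h1 := mgf s erefl.
have h2 := mgf (- s) (sqrrN s).
move: h2; under eq_Eprod do rewrite mulNr.
lra.
Qed.

(** * Discrete Taylor expansion *)

Definition fdiff (R : zmodType) (u : nat -> R) (i : nat) : R := u i.+1 - u i.

(** Extension by zero lets differences be iterated without changing dimension. The entries of the
    [r]-th difference with index below [n - r] see only genuine entries of [v]. *)
Definition row_ext (R : zmodType) (n : nat) (v : 'rV[R]_n) (i : nat) : R :=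
  if insub i is Some j then v 0 j else 0.

Lemma row_extE (R : zmodType) (n : nat) (v : 'rV[R]_n) (i : 'I_n) :
  row_ext v i = v 0 i.
Proof. by rewrite /row_ext valK. Qed.

Lemma iter_predn r n : iter r predn n = (n - r)%N.
Proof. by elim: r => [|r /= ->]; rewrite ?subn0 // subnS. Qed.

Lemma discrete_diffE (R : realType) (r n : nat) (v : 'rV[R]_n)
    (j : 'I_(iter r predn n)) :
  discrete_diff r v 0 j = iter r (@fdiff R) (row_ext v) j.
Proof.
elim: r j => [|r IH] j; first exact/esym/(@row_extE R n).
by rewrite /= mxE !IH.
Qed.

Lemma trend_variationE (R : realType) (r n : nat) (v : 'rV[R]_n) :
  trend_variation r v =
  n%:R ^+ r.-1 * \sum_(j < n - r) `|iter r (@fdiff R) (row_ext v) j|.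
Proof.
rewrite /trend_variation; congr (_ * _).
under eq_bigr do rewrite discrete_diffE.
by rewrite -(big_mkord xpredT (fun j => `|iter r (@fdiff R) (row_ext v) j|))
  iter_predn big_mkord.
Qed.

Lemma discrete_diffD (R : realType) (r n : nat) (u v : 'rV[R]_n) :
  discrete_diff r (u + v) = discrete_diff r u + discrete_diff r v.
Proof.
by elim: r => //= r ->; apply/rowP => j; rewrite !mxE; ring.
Qed.

Lemma discrete_diffZ (R : realType) (r n : nat) a (v : 'rV[R]_n) :
  discrete_diff r (a *: v) = a *: discrete_diff r v.
Proof.
by elim: r => //= r ->; apply/rowP => j; rewrite !mxE; ring.
Qed.

Lemma trend_variation_ge0 (R : realType) (r n : nat) (v : 'rV[R]_n) :
  0 <= trend_variation r v.
Proof. by rewrite mulr_ge0 ?exprn_ge0 // sumr_ge0. Qed.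

Lemma trend_variationD (R : realType) (r n : nat) (u v : 'rV[R]_n) :
  trend_variation r (u + v) <= trend_variation r u + trend_variation r v.
Proof.
rewrite -mulrDr ler_wpM2l ?exprn_ge0 // -big_split; apply: ler_sum => j _.
by rewrite discrete_diffD mxE ler_normD.
Qed.

Lemma trend_variationZ (R : realType) (r n : nat) a (v : 'rV[R]_n) :
  trend_variation r (a *: v) = `|a| * trend_variation r v.
Proof.
rewrite mulrCA mulr_sumr; congr (_ * _); apply: eq_bigr => j _.
by rewrite discrete_diffZ mxE normrM.
Qed.

(** Summation by parts with Pascal's rule; it raises the order of the Taylor remainder by one. *)
Lemma sum_bin_fdiff (R : pzRingType) (g : nat -> R) (r x : nat) :
  \sum_(j < x) 'C(x - j.+1, r)%:R * g j =
  'C(x, r.+1)%:R * g 0%N + \sum_(j < x) 'C(x - j.+1, r.+1)%:R * fdiff g j.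
Proof.
case: x => [|x]; first by rewrite !big_ord0 bin0n mul0r addr0.
under [in RHS]eq_bigr do rewrite /fdiff mulrBr.
rewrite sumrB.
have -> : \sum_(j < x.+1) 'C(x.+1 - j.+1, r.+1)%:R * g j.+1 =
  \sum_(j < x.+1) 'C(x.+1 - j, r.+1)%:R * g j - 'C(x.+1, r.+1)%:R * g 0%N.
  rewrite [in RHS]big_ord_recl /= subn0 [in RHS]addrC addrA addNr add0r.
  by rewrite big_ord_recr /= subnn bin0n mul0r addr0.
rewrite addrA [X in X - _]addrC subrK -sumrB; apply: eq_bigr => j _.
have jx : (j <= x)%N by rewrite -ltnS ltn_ord.
by rewrite -mulrBl (subSn jx) subSS binS natrD addrAC subrr add0r.
Qed.

(** Newton's forward difference formula with remainder. The base case telescopes, and the induction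
    step is [sum_bin_fdiff]. *)
Lemma discrete_taylor (R : pzRingType) (u : nat -> R) (r a x : nat) :
  u (a + x)%N = \sum_(k < r.+1) 'C(x, k)%:R * iter k (@fdiff R) u a
   + \sum_(j < x) 'C(x - j.+1, r)%:R * iter r.+1 (@fdiff R) u (a + j)%N.
Proof.
elim: r => [|r IH].
  rewrite big_ord_recr big_ord0 /= bin0 mul1r add0r.
  elim: x => [|x IH]; first by rewrite big_ord0 addn0 addr0.
  rewrite big_ord_recr /= bin0 mul1r addrA.
  under eq_bigr do rewrite bin0 mul1r.
  move: IH; under eq_bigr do rewrite bin0 mul1r.
  by move=> <-; rewrite /fdiff addnS addrC subrK.
rewrite IH big_ord_recr [in RHS]big_ord_recr /= -[RHS]addrA.
rewrite big_ord_recr /= -!addrA; congr (_ + (_ + _)).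
rewrite (sum_bin_fdiff (fun j => fdiff (iter r (@fdiff R) u) (a + j)%N)).
rewrite addn0; congr (_ + _); apply: eq_bigr => j _.
by rewrite /fdiff addnS.
Qed.

(* The remainder terms with j >= n - r.+1 drop out because their binomial
   coefficients vanish. *)
Lemma taylor_range (R : pzRingType) (u : nat -> R) (r n a x : nat) :
  (a + x < n)%N ->
  u (a + x)%N = \sum_(k < r.+1) 'C(x, k)%:R * iter k (@fdiff R) u a
   + \sum_(j < n - r.+1) (if (a <= j < a + x)%N then 'C(a + x - j.+1, r)%:R
                          else 0) * iter r.+1 (@fdiff R) u j.
Proof.
move=> axn; rewrite (discrete_taylor u r); congr (_ + _).
pose G j := 'C(a + x - j.+1, r)%:R * iter r.+1 (@fdiff R) u j.
rewrite (eq_bigr (fun j : 'I_x => G (j + a)%N)); last first.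
  by move=> j _; rewrite /G [(j + a)%N]addnC -addnS subnDl.
rewrite -(big_mkord xpredT (fun j => G (j + a)%N)).
pose H j := if (a <= j < a + x)%N then G j else 0.
rewrite [RHS](eq_bigr (fun j : 'I_(n - r.+1) => H j)); last first.
  by move=> j _; rewrite /H /G; case: ifP; rewrite ?mul0r.
rewrite -(big_mkord xpredT H).
have -> : \sum_(0 <= j < n - r.+1) H j = \sum_(0 <= j < n) H j.
  rewrite [RHS](@big_cat_nat _ _ _ (n - r.+1)) ?leq_subr //=.
  rewrite [X in _ + X]big_nat_cond [X in _ + X]big1 ?addr0 // => j.
  rewrite andbT => /andP[jn _]; rewrite /H; case: ifP => // /andP[aj jx].
  by rewrite /G bin_small ?mul0r //; lia.
rewrite [RHS](@big_cat_nat _ _ _ a) ?leq0n /=; [|lia|lia].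
rewrite [X in _ = X + _]big_nat_cond [X in _ = X + _]big1
  ?add0r => [|j]; last first.
  by rewrite andbT /H => /andP[_ ja]; case: ifP => //; lia.
rewrite [RHS](@big_cat_nat _ _ _ (a + x)) /=; [|lia|lia].
rewrite [X in _ = _ + X]big_nat_cond [X in _ = _ + X]big1
  ?addr0 => [|j]; last first.
  by rewrite andbT /H => /andP[ja _]; case: ifP => //; lia.
rewrite -{2}[a]add0n [in RHS]big_addn addKn.
by rewrite big_nat [RHS]big_nat; apply: eq_bigr => j jx; rewrite /H ifT //; lia.
Qed.

Lemma leq_expl (m n e : nat) : (m <= n -> m ^ e <= n ^ e)%N.
Proof. by case: e => // e mn; rewrite leq_exp2r. Qed.

Lemma bin_le_exp (m k : nat) : ('C(m, k) <= m ^ k)%N.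
Proof.
apply: (@leq_trans (m ^_ k)).
  by rewrite -bin_ffact leq_pmulr // fact_gt0.
elim: k m => [|k IH] [|m] //; rewrite ffactSS expnS leq_pmul2l //.
by apply: leq_trans (IH m) _; apply: leq_expl.
Qed.

Lemma leq_double_divn (n m : nat) : (0 < m -> m <= n -> n <= 2 * m * (n %/ m))%N.
Proof.
move=> m0 mn; have := divn_eq n m; have := ltn_pmod n m0.
have : (0 < n %/ m)%N by rewrite divn_gt0.
by move: (n %/ m)%N (n %% m)%N => u v; nia.
Qed.

Lemma count_window (n j l : nat) :
  (\sum_(i < n) (j < i <= j + l) <= l)%N.
Proof.
rewrite -(big_mkord xpredT (fun i => nat_of_bool (j < i <= j + l)%N)).
suff : (\sum_(0 <= i < n) (j < i <= j + l) <= minn l (n - j.+1))%N.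
  by move=> h; apply: leq_trans h (geq_minl _ _).
elim: n => [|n IH]; first by rewrite big_nil.
rewrite big_nat_recr //=.
by case: (boolP (j < n <= j + l)%N) => /= h; lia.
Qed.

(* Taylor expansion on each block of l indices around its first index: the rows
   of A are the block monomials, those of Q the truncated powers. *)
Lemma block_decomposition (R : realType) (r n l : nat) : (0 < l)%N ->
  exists (A : 'M[R]_((n %/ l).+1 * r.+1, n)) (Q : 'M[R]_(n - r.+1, n)),
    (forall v : 'rV[R]_n, exists c,
      v = c *m A + (\row_j iter r.+1 (@fdiff R) (row_ext v) j) *m Q) /\
    (forall j, \sum_i Q j i ^+ 2 <= l%:R ^+ (2 * r).+1).
Proof.
move=> l0; set nb := (n %/ l).+1.
pose A : 'M[R]_(nb * r.+1, n) := (\matrix_(i < n) mxvec (\matrix_(b < nb, k < r.+1)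
   (if (i %/ l == b)%N then 'C(i %% l, k)%:R else 0)))^T.
pose Q : 'M[R]_(n - r.+1, n) := \matrix_(j, i)
   (if (i %/ l * l <= j < i)%N then 'C(i - j.+1, r)%:R else 0).
exists A, Q; split=> [v|j].
  pose c : 'rV[R]_(nb * r.+1) := mxvec (\matrix_(b < nb, k < r.+1)
     iter k (@fdiff R) (row_ext v) (b * l)%N).
  exists c; apply/rowP => i.
  rewrite -row_extE [X in row_ext v X](divn_eq i l).
  rewrite (@taylor_range _ (row_ext v) r n) -?divn_eq // mxE.
  congr (_ + _); last by rewrite mxE; apply: eq_bigr => j _; rewrite !mxE mulrC.
  have bi : (i %/ l < nb)%N by rewrite ltnS leq_div2r // ltnW.
  rewrite mxE (reindex _ (curry_mxvec_bij nb r.+1)) /=.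
  rewrite (eq_bigr (fun bk : 'I_nb * 'I_r.+1 => c 0 (mxvec_index bk.1 bk.2) *
     A (mxvec_index bk.1 bk.2) i)); last by case.
  rewrite -(pair_bigA _ (fun b k => c 0 (mxvec_index b k) *
     A (mxvec_index b k) i)) /= (bigD1 (Ordinal bi)) //= [X in _ = _ + X]big1.
    rewrite addr0; apply: eq_bigr => k _.
    by rewrite !mxE !mxvecE !mxE eqxx mulrC.
  move=> b bneq; apply: big1 => k _; rewrite !mxE mxvecE mxE ifF ?mulr0 //.
  by apply: contraNF bneq => /eqP e; apply/eqP/val_inj.
(* Row [j] is supported on a window of [l] indices inside one block, and its entries are at most
   [l ^ r]; this gives the exponent [2 * r + 1]. *)
apply: (@le_trans _ _ (\sum_(i < n) (j < i <= j + l)%N%:R * l%:R ^+ (2 * r))).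
  apply: ler_sum => i _; rewrite mxE; case: ifP => [/andP[h1 h2]|_].
    have := divn_eq i l; have := ltn_pmod i l0 => ml dl.
    rewrite (_ : (j < i <= j + l)%N = true) ?mul1r; last by lia.
    rewrite mulnC exprM ler_pXn2r ?nnegrE ?ler0n ?exprn_ge0 // -natrX ler_nat.
    apply: leq_trans (bin_le_exp _ _) _.
    by apply: leq_expl; lia.
  by rewrite expr0n /= mulr_ge0 ?ler0n ?exprn_ge0.
rewrite -mulr_suml exprS ler_wpM2r ?exprn_ge0 ?ler0n // -natr_sum ler_nat.
exact: count_window.
Qed.

(** * Polynomial interpolation and the uniform bound *)

Definition fall_poly (R : fieldType) (k : nat) : {poly R} :=
  k`!%:R^-1 *: \prod_(l < k) ('X - l%:R%:P).

Lemma size_fall_poly (R : fieldType) (k : nat) :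
  (size (fall_poly R k) <= k.+1)%N.
Proof.
apply: leq_trans (size_scale_leq _ _) _.
by rewrite size_prod_XsubC /index_enum -enumT size_enum_ord.
Qed.

Lemma horner_fall_poly (R : numFieldType) (k i : nat) :
  (fall_poly R k).[i%:R] = 'C(i, k)%:R.
Proof.
rewrite /fall_poly hornerZ horner_prod.
have -> : \prod_(l < k) ('X - l%:R%:P).[i%:R] = (i ^_ k)%:R :> R.
  case: (ltnP i k) => ik.
    rewrite ffact_small // (bigD1 (Ordinal ik)) //= hornerXsubC subrr mul0r //.
  elim: k ik => [|k IH] ik; first by rewrite big_ord0 ffactn0.
  by rewrite big_ord_recr /= IH 1?ltnW // ffactnSr natrM hornerXsubC natrB // ltnW.
by rewrite -bin_ffact natrM mulrC mulfK // pnatr_eq0 -lt0n fact_gt0.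
Qed.

(** Lagrange interpolation at [r.+1] nodes: each basis polynomial at [z] is a product of [r] ratios
    bounded by [H / h]. *)
Lemma lagrange_bound (R : realFieldType) (r : nat) (x : nat -> R) (p : {poly R})
    (z q h H : R) :
  injective x -> (size p <= r.+1)%N -> 0 < h -> 0 <= q ->
  (forall i j, i != j -> h <= `|x i - x j|) ->
  (forall i : 'I_r.+1, `|z - x i| <= H) ->
  (forall i : 'I_r.+1, `|p.[x i]| <= q) ->
  `|p.[z]| <= r.+1%:R * (q * (H / h) ^+ r).
Proof.
move=> xinj sp h0 q0 hx hz hp; rewrite (lagrange_gen _ xinj sp) //.
rewrite horner_sum; apply: le_trans (ler_norm_sum _ _ _) _.
rewrite -[r.+1 in leRHS]card_ord mulr_natl -sumr_const; apply: ler_sum => i _.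
rewrite lagrangeE //= !hornerM !hornerC !normrM ler_pM //.
rewrite -normrM !horner_prod -prodfV -big_split /= normr_prod.
have -> : (H / h) ^+ r = \prod_(j < r.+1 | j != i) (H / h).
  by rewrite prodr_const cardC1 card_ord.
apply: ler_prod => j ji; rewrite normr_ge0 /= !hornerXsubC mulrC normrM normfV.
rewrite ler_pM ?invr_ge0 // lef_pV2 ?posrE ?hx //; first by rewrite eq_sym.
by apply: lt_le_trans (hx _ _ _); rewrite // eq_sym.
Qed.

(** The first summand is [lagrange_bound] with [q = 1 + D] and ratio at most [4 * r.+1]; the second
    bounds the Taylor remainder. *)
Definition sup_const (R : realFieldType) (r : nat) (D : R) : R :=
  r.+1%:R * ((1 + D) * (4 * r.+1)%:R ^+ r) + D.

(* A vector of small average loss is at most 1 at r.+1 well separated indices,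
   which controls the polynomial part of its Taylor expansion. *)
Lemma sup_bound (R : realType) (r n : nat) (v : 'rV[R]_n) (D : R) :
  (2 * r.+1 <= n)%N ->
  trend_variation r.+1 v <= D ->
  \sum_i Num.min `|v 0 i| (v 0 i ^+ 2) < (n %/ (2 * r.+1))%:R ->
  forall i, `|v 0 i| <= sup_const r D.
Proof.
set h := (n %/ _)%N => rn vD small.
have h0 : (0 < h)%N by rewrite divn_gt0.
have hn : (2 * r.+1 * h <= n)%N by rewrite mulnC leq_trunc_div.
have nh : (n <= 4 * r.+1 * h)%N.
  by have := leq_double_divn (isT : (0 < 2 * r.+1)%N) rn; rewrite mulnA.
pose u := row_ext v.
pose q i : R := \sum_(j < n - r.+1) (if (j < i)%N then 'C(i - j.+1, r)%:R
                          else 0) * iter r.+1 (@fdiff R) u j.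
pose p : {poly R} := \sum_(k < r.+1) iter k (@fdiff R) u 0%N *: fall_poly R k.
have upq i : (i < n)%N -> u i = p.[i%:R] + q i.
  move=> i_n; rewrite -[i in LHS]add0n (@taylor_range _ u r n) //; congr (_ + _).
  rewrite horner_sum; apply: eq_bigr => k _.
  by rewrite hornerZ horner_fall_poly mulrC.
(* The truncated powers are at most [n ^ r], which is the normalizing factor of the trend variation
   of order [r.+1]. *)
have qD i : (i < n)%N -> `|q i| <= D.
  move=> i_n; apply: le_trans vD; rewrite trend_variationE mulr_sumr.
  apply: le_trans (ler_norm_sum _ _ _) _; apply: ler_sum => j _.
  rewrite normrM ler_wpM2r // /=; case: ifP => _; last by rewrite normr0 exprn_ge0.
  rewrite ger0_norm ?ler0n // -natrX ler_nat; apply: leq_trans (bin_le_exp _ _) _.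
  by apply: leq_expl; lia.
have D0 : 0 <= D by apply: le_trans vD; apply: trend_variation_ge0.
(* If all [h] entries of a window exceeded 1, the window alone would violate [small]. Windows
   alternate with gaps of length [h], so the chosen indices are separated. For [j > r] the start of
   the window is a default, which keeps the nodes distinct over all of [nat]. *)
have good (j : nat) : exists i, (2 * j * h <= i < 2 * j * h + h)%N /\
    ((j < r.+1)%N -> `|u i| <= 1).
  case: (leqP r.+1 j) => jr; first by exists (2 * j * h)%N; split=> //; lia.
  apply: contrapT => bad; move: small; apply/negP; rewrite -leNgt.
  have big i : (2 * j * h <= i < 2 * j * h + h)%N -> 1 < `|u i|.
    move=> hi; rewrite ltNge; apply/negP => ui; apply: bad; exists i; split=> //.
  pose G i : R := Num.min `|u i| (u i ^+ 2).
  have G0 i : 0 <= G i by rewrite /G le_min normr_ge0 sqr_ge0.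
  rewrite (eq_bigr (fun i : 'I_n => G i)); last first.
    by move=> i _; rewrite /G /u row_extE.
  rewrite -(big_mkord xpredT G).
  rewrite (@big_cat_nat _ _ _ (2 * j * h)) //=; last by nia.
  rewrite [X in _ + X](@big_cat_nat _ _ _ (2 * j * h + h)) //=; [|lia|nia].
  have -> : h%:R = \sum_(2 * j * h <= i < 2 * j * h + h) 1 :> R.
    by rewrite sumr_const_nat addKn.
  have mid : \sum_(2 * j * h <= i < 2 * j * h + h) 1 <=
      \sum_(2 * j * h <= i < 2 * j * h + h) G i.
    rewrite big_nat [leRHS]big_nat; apply: ler_sum => i /big ui.
    by rewrite /G le_min ltW //= -real_normK ?num_real // exprn_ege1 // ltW.
  have s1 : 0 <= \sum_(0 <= i < 2 * j * h) G i by apply: sumr_ge0.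
  have s2 : 0 <= \sum_(2 * j * h + h <= i < n) G i by apply: sumr_ge0.
  lra.
have [x hxg] := choice good.
have x_n (j : 'I_r.+1) : (x j < n)%N.
  by have [/andP[_ h2] _] := hxg j; have := ltn_ord j; nia.
have sep i j : (i < j)%N -> (x i + h <= x j)%N.
  have [/andP[_ h2] _] := hxg i; have [/andP[h3 _] _] := hxg j; nia.
have sepR i j : i != j -> h%:R <= `|(x i)%:R - (x j)%:R| :> R.
  rewrite neq_ltn => /orP[] /sep.
    rewrite -(ler_nat R) natrD => H; rewrite distrC ger0_norm; first by lra.
    have : (0 : R) <= h%:R by []. by lra.
  rewrite -(ler_nat R) natrD => H; rewrite ger0_norm; first by lra.
  have : (0 : R) <= h%:R by []. by lra.
move=> i; rewrite -row_extE -/u upq //.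
apply: le_trans (ler_normD _ _) _; rewrite /sup_const lerD ?qD //.
have hR : (0 : R) < h%:R by rewrite ltr0n.
have H : `|p.[i%:R]| <= r.+1%:R * ((1 + D) * (n%:R / h%:R) ^+ r).
  apply: (@lagrange_bound _ r (fun j => (x j)%:R)) => //.
  - move=> j k /eqP; rewrite eqr_nat => /eqP jk; apply/eqP/negPn/negP => njk.
    by have := sepR _ _ njk; rewrite jk subrr normr0 leNgt hR.
  - apply: leq_trans (size_sum _ _ _) _; apply/bigmax_leqP => k _.
    apply: leq_trans (size_scale_leq _ _) _.
    by apply: leq_trans (size_fall_poly _ _) _; rewrite ltn_ord.
  - by lra.
  - move=> j; rewrite ler_norml; have := x_n j; have := ltn_ord i.
    rewrite -!(ltr_nat R); have : (0:R) <= (x j)%:R by [].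
    have : (0:R) <= i%:R by [].
    lra.
  - move=> j; have [_ /(_ (ltn_ord j))] := hxg j; rewrite upq // => ux.
    rewrite -[p.[_]](addrK (q (x j))); apply: le_trans (ler_normB _ _) _.
    by rewrite lerD // qD.
apply: le_trans H _; rewrite ler_wpM2l ?ler0n // ler_wpM2l //; first by lra.
rewrite lerXn2r ?nnegrE ?ler0n ?divr_ge0 ?ler0n // ler_pdivrMr //.
by rewrite -natrM ler_nat.
Qed.

(** * The check loss and its discretization *)

Lemma check_loss_incr (R : realType) (tau z h : R) :
  0 <= tau <= 1 -> 0 <= h ->
  (tau - 1) * h <= check_loss tau (z + h) - check_loss tau z <= tau * h.
Proof.
move=> /andP[t0 t1] h0; rewrite /check_loss.
by case: (leP (tau * z)); case: (leP (tau * (z + h))) => *; apply/andP; split; nra.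
Qed.

Definition loss_diff (R : realType) (tau x a : R) : R :=
  check_loss tau (x - a) - check_loss tau x.

Lemma loss_diff0 (R : realType) (tau x : R) : loss_diff tau x 0 = 0.
Proof. by rewrite /loss_diff subr0 subrr. Qed.

(** All slopes of the check loss lie between [tau - 1] and [tau], an interval of length 1; hence the
    Lipschitz constant 1 needed for contraction. *)
Lemma loss_diff_lip2 (R : realType) (tau x y s t : R) : 0 <= tau <= 1 ->
  (loss_diff tau y s - loss_diff tau x s) -
  (loss_diff tau y t - loss_diff tau x t) <= `|s - t|.
Proof.
move=> ht; rewrite /loss_diff; case: (lerP s t) => st.
  have st0 : 0 <= t - s by lra.
  have /andP[] := check_loss_incr (x - t) ht st0.
  have /andP[] := check_loss_incr (y - t) ht st0.
  have E w : w - t + (t - s) = w - s by ring.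
  rewrite !E.
  by lra.
have st0 : 0 <= s - t by lra.
have /andP[] := check_loss_incr (x - s) ht st0.
have /andP[] := check_loss_incr (y - s) ht st0.
have E w : w - s + (s - t) = w - t by ring.
rewrite !E.
by lra.
Qed.

Lemma loss_diff_lip1 (R : realType) (tau x y a : R) : 0 <= tau <= 1 ->
  `|loss_diff tau x a - loss_diff tau y a| <= `|x - y|.
Proof.
move=> ht; wlog xy : x y / x <= y => [H|].
  case: (leP x y) => [/H//|yx].
  by rewrite distrC (distrC x); apply: H; exact: ltW.
have xy0 : 0 <= y - x by lra.
have /andP[] := check_loss_incr (x - a) ht xy0.
have /andP[] := check_loss_incr x ht xy0.
rewrite /loss_diff (_ : x - a + (y - x) = y - a); last by ring.
rewrite (_ : x + (y - x) = y); last by ring.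
by rewrite (ler0_norm (_ : x - y <= 0)) ?ler_norml; lra.
Qed.

Lemma check_loss_ge0E (R : realType) (tau x : R) : 0 <= x ->
  check_loss tau x = tau * x.
Proof. by move=> x0; rewrite /check_loss max_l //; nra. Qed.

Lemma check_loss_le0E (R : realType) (tau x : R) : x <= 0 ->
  check_loss tau x = (tau - 1) * x.
Proof. by move=> x0; rewrite /check_loss max_r //; nra. Qed.

(** Beyond [[- A, A]] both [x] and [x - a] stay on one linear piece, so the difference no longer
    depends on [x]. This makes a finite discretization possible for unbounded data. *)
Lemma loss_diff_clip (R : realType) (tau x a A : R) : `|a| <= A ->
  loss_diff tau x a = loss_diff tau (Num.max (- A) (Num.min x A)) a.
Proof.
rewrite ler_norml => /andP[a1 a2]; rewrite /loss_diff.
case: (leP x A) => xA.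
  case: (leP (- A) x) => // Ax.
  by rewrite !check_loss_le0E; lra.
rewrite max_r; last by lra.
by rewrite !check_loss_ge0E; lra.
Qed.

(* Integrated against the law of x this bounds the expected excess loss below
   by a / 2 * (F (a / 2) - F 0) when F 0 = tau. *)
Lemma loss_diff_ge (R : realType) (tau x a : R) :
  - tau * a + a / 2 * ((x <= 0)%R%:R + (x <= a / 2)%R%:R) <= loss_diff tau x a.
Proof.
rewrite /loss_diff; case: (lerP (x - a) 0) => h1; case: (lerP x 0) => h2.
- rewrite !check_loss_le0E //; case: (lerP x (a / 2)) => h3 /=; lra.
- rewrite (check_loss_le0E _ h1) (check_loss_ge0E _ (ltW h2)).
  case: (lerP x (a / 2)) => h3 /=; nra.
- rewrite (check_loss_ge0E _ (ltW h1)) (check_loss_le0E _ h2).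
  case: (lerP x (a / 2)) => h3 /=; nra.
- rewrite (check_loss_ge0E _ (ltW h1)) (check_loss_ge0E _ (ltW h2)).
  case: (lerP x (a / 2)) => h3 /=; nra.
Qed.

Lemma check_loss_convex (R : realType) (tau x v a : R) : 0 <= a <= 1 ->
  loss_diff tau x (a * v) <= a * loss_diff tau x v.
Proof.
move=> /andP[a0 a1]; rewrite /loss_diff lerBlDr {1}/check_loss ge_max.
have l1 z : tau * z <= check_loss tau z by rewrite /check_loss le_max lexx.
have l2 z : (tau - 1) * z <= check_loss tau z.
  by rewrite /check_loss le_max lexx orbT.
have := l1 x; have := l2 x; have := l1 (x - v); have := l2 (x - v).
by move=> *; apply/andP; split; nra.
Qed.

(* x is clipped to [- A, A], then rounded down to a multiple of delta. *)
Lemma loss_discretization (R : realType) (tau A delta : R) :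
  0 <= tau <= 1 -> 0 <= A -> 0 < delta ->
  exists N (g : R -> 'I_N.+1) (rep : 'I_N.+1 -> R),
    (forall k, measurable (g @^-1` [set k])) /\
    (forall x a, `|a| <= A ->
       `|loss_diff tau x a - loss_diff tau (rep (g x)) a| <= delta).
Proof.
move=> ht A0 d0.
pose clip x := Num.max (- A) (Num.min x A).
have clip_itv x : - A <= clip x <= A.
  by rewrite /clip le_max lexx ge_max ge_min lexx orbT andbT /=; lra.
pose t x := (clip x + A) / delta.
have t0 x : 0 <= t x.
  by apply: divr_ge0; [have /andP[] := clip_itv x; lra|exact: ltW].
pose N := Num.trunc (2 * A / delta).
have tN x : (Num.trunc (t x) < N.+1)%N.
  rewrite ltnS; apply: le_truncn; rewrite ler_pM2r ?invr_gt0 //.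
  by have /andP[] := clip_itv x; lra.
pose g x : 'I_N.+1 := Ordinal (tN x).
exists N, g, (fun k => k%:R * delta - A); split=> [k|x a aA].
  have -> : g @^-1` [set k] = [set x | k%:R <= t x] `&` [set x | t x < k.+1%:R].
    apply/seteqP; split=> x /=.
      by move=> <-; have /andP[] := truncn_itv (t0 x).
    move=> [h1 h2]; apply/val_inj => /=; apply/truncn_def; rewrite h1 h2 //.
  have mt : measurable_fun setT t.
    apply: measurable_funM => //; apply: measurable_funD => //.
    by apply: measurable_maxr => //; apply: measurable_minr.
  apply: measurableI.
    by rewrite -[X in measurable X]setTI; apply: measurable_fun_le.
  rewrite (_ : [set x | t x < k.+1%:R] = ~` [set x | k.+1%:R <= t x]).
    apply: measurableC; rewrite -[X in measurable X]setTI.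
    exact: measurable_fun_le.
  by apply/seteqP; split=> x /=; rewrite ltNge => /negP.
rewrite (loss_diff_clip _ _ aA) -/(clip x).
apply: le_trans (loss_diff_lip1 _ _ _ ht) _ => /=.
have /andP[h1 h2] := truncn_itv (t0 x).
move: h1 h2; rewrite {2 3}/t ler_pdivlMr // ltr_pdivrMr // -natr1 => h1 h2.
by rewrite ler_norml; apply/andP; split; lra.
Qed.

Lemma sum_bool2 (V : nmodType) (F : bool * bool -> V) :
  \sum_j F j = (F (true, true) + F (true, false)) +
               (F (false, true) + F (false, false)).
Proof.
rewrite (eq_bigr (fun j => F (j.1, j.2))); last by case.
by rewrite -(pair_bigA _ (fun u v => F (u, v))) !big_bool.
Qed.

(** * Probabilities of fibers and expectations as finite sums *)

Section finite_laws.
Context {d : measure_display} {T : measurableType d} {R : realType}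
        (P : probability T R).

Definition pr (A : set T) : R := fine (P A).

Lemma prE (A : set T) : measurable A -> P A = (pr A)%:E.
Proof. by move=> mA; rewrite /pr fineK // fin_num_measure. Qed.

Lemma pr_ge0 (A : set T) : 0 <= pr A.
Proof. exact: fine_ge0. Qed.

Lemma le_pr (A B : set T) : measurable A -> measurable B -> A `<=` B ->
  pr A <= pr B.
Proof.
by move=> mA mB AB; rewrite -lee_fin -!prE // le_measure // inE.
Qed.

Lemma prT : pr setT = 1.
Proof. by rewrite /pr probability_setT. Qed.

Lemma pr0 : pr set0 = 0.
Proof. by rewrite /pr measure0. Qed.

Lemma pr_bigcup (K : finType) (Q : pred K) (F : K -> set T) :
  (forall k, measurable (F k)) -> trivIset setT F ->
  pr (\bigcup_(k in [set k | Q k]) F k) = \sum_(k | Q k) pr (F k).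
Proof.
move=> mF tF; have -> : [set k | Q k] = [set` [seq k <- index_enum K | Q k]].
  by apply/seteqP; split=> k /=; rewrite mem_filter mem_index_enum andbT.
rewrite /pr measure_fin_bigcup //; last first.
- exact: sub_trivIset tF.
rewrite -fsbig_seq ?filter_uniq ?index_enum_uniq // big_filter sum_fine // => k _.
exact: fin_num_measure.
Qed.

Lemma trivIset_fiber (K : Type) (g : T -> K) (A : set T) :
  trivIset setT (fun k => A `&` g @^-1` [set k]).
Proof. by move=> k l _ _ [x [[_ /= <-] [_ /= <-]]]. Qed.

Lemma pr_fibers (K : finType) (g : T -> K) (A : set T) :
  (forall k, measurable (g @^-1` [set k])) -> measurable A ->
  pr A = \sum_k pr (A `&` g @^-1` [set k]).
Proof.
move=> mg mA; rewrite -pr_bigcup; last first.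
- exact: trivIset_fiber.
- by move=> k; apply: measurableI.
congr pr; apply/seteqP; split=> [x Ax|x [k _ [Ax _]]] //.
by exists (g x).
Qed.

(** Both sums are refined to the joint fibers of [g] and [h]. Any point of a nonempty joint fiber
    yields the inequality of values there; empty ones have weight 0. *)
Lemma le_pr_sum (K J : finType) (g : T -> K) (h : T -> J) (c : K -> R)
    (e : J -> R) :
  (forall k, measurable (g @^-1` [set k])) ->
  (forall j, measurable (h @^-1` [set j])) ->
  (forall w, e (h w) <= c (g w)) ->
  \sum_j pr (h @^-1` [set j]) * e j <= \sum_k pr (g @^-1` [set k]) * c k.
Proof.
move=> mg mh ec.
under eq_bigr => j _ do rewrite (pr_fibers mg) // mulr_suml.
under [leRHS]eq_bigr => k _ do rewrite (pr_fibers mh) // mulr_suml.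
rewrite exchange_big /=; apply: ler_sum => k _; apply: ler_sum => j _.
rewrite [X in pr X * c k]setIC.
have [->|/set0P[w [/= hw gw]]] := eqVneq (h @^-1` [set j] `&` g @^-1` [set k]) set0.
  by rewrite pr0 !mul0r.
by rewrite ler_wpM2l ?pr_ge0 // -hw -gw.
Qed.

(* The discretized expected excess loss still satisfies the lower bound, up to
   the discretization error. *)
Lemma expected_loss_ge (tau a delta L f : R) (X : T -> R) (K : finType)
    (g : T -> K) (c : K -> R) :
  0 < L -> 0 < f -> measurable_fun setT X ->
  (forall k, measurable (g @^-1` [set k])) ->
  (forall w, loss_diff tau (X w) a - delta <= c (g w)) ->
  pr [set w | X w <= 0] = tau ->
  (forall b, `|b| <= L ->
     f * `|b| <= `|pr [set w | X w <= b] - pr [set w | X w <= 0]|) ->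
  Num.min (f / 4) (f * L / 2) * Num.min `|a| (a ^+ 2) - delta <=
  \sum_k pr (g @^-1` [set k]) * c k.
Proof.
move=> L0 f0 mX mg cge F0 growth.
have mle b : measurable [set w | X w <= b].
  by rewrite -[X in measurable X]setTI; apply: measurable_fun_le.
have monoF b b' : b <= b' -> pr [set w | X w <= b] <= pr [set w | X w <= b'].
  by move=> bb; apply: le_pr => // w /= /le_trans; apply.
(* The lower bound of [loss_diff_ge] depends on [w] only through these two comparisons, so its
   expectation is a sum over four cells. *)
pose h w : bool * bool := (X w <= 0, X w <= a / 2).
pose e (j : bool * bool) : R := - tau * a - delta + a / 2 * (j.1%:R + j.2%:R).
have mfib (b : R) (j : bool) : measurable [set w | (X w <= b) = j].
  case: j; first exact: mle.
  have -> : [set w | (X w <= b) = false] = ~` [set w | X w <= b].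
    by apply/seteqP; split=> w /= => [->//|/negP/negPf].
  exact: measurableC.
have mh j : measurable (h @^-1` [set j]).
  have -> : h @^-1` [set j] =
     [set w | (X w <= 0) = j.1] `&` [set w | (X w <= a / 2) = j.2].
    by apply/seteqP; split=> w /=; rewrite /h; case: j => u v /= [-> ->].
  exact: measurableI.
apply: le_trans (le_pr_sum (e := e) mg mh _); last first.
  move=> w; apply: le_trans (cge w); rewrite /e /h /=.
  by have := loss_diff_ge tau (X w) a; lra.
have E1 : pr [set w | X w <= 0] =
    pr (h @^-1` [set (true, true)]) + pr (h @^-1` [set (true, false)]).
  have i1 v : [set w | X w <= 0] `&` h @^-1` [set (true, v)] =
      h @^-1` [set (true, v)].
    by apply/seteqP; split=> w /= => [[]//|hw]; split=> //; case: hw.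
  have i2 v : [set w | X w <= 0] `&` h @^-1` [set (false, v)] = set0.
    by apply/seteqP; split=> w //= [X0 [XF _]]; rewrite X0 in XF.
  by rewrite (pr_fibers (g := h)) // sum_bool2 !i1 !i2 pr0 !addr0.
have E2 : pr [set w | X w <= a / 2] =
    pr (h @^-1` [set (true, true)]) + pr (h @^-1` [set (false, true)]).
  have i1 v : [set w | X w <= a / 2] `&` h @^-1` [set (v, true)] =
      h @^-1` [set (v, true)].
    by apply/seteqP; split=> w /= => [[]//|hw]; split=> //; case: hw.
  have i2 v : [set w | X w <= a / 2] `&` h @^-1` [set (v, false)] = set0.
    by apply/seteqP; split=> w //= [X0 [_ XF]]; rewrite X0 in XF.
  by rewrite (pr_fibers (g := h)) // sum_bool2 !i1 !i2 pr0 !addr0.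
have E0 : 1 = (pr (h @^-1` [set (true, true)]) + pr (h @^-1` [set (true, false)]))
    + (pr (h @^-1` [set (false, true)]) + pr (h @^-1` [set (false, false)])).
  rewrite -prT (pr_fibers (g := h)) // sum_bool2.
  by rewrite !setTI.
rewrite sum_bool2 /e /=.
move: E1 E2 E0; set q11 := pr (h @^-1` [set (true, true)]).
set q10 := pr (h @^-1` [set (true, false)]).
set q01 := pr (h @^-1` [set (false, true)]).
set q00 := pr (h @^-1` [set (false, false)]) => E1 E2 E0.
set m := Num.min _ _; set mm := Num.min _ _.
set G := pr [set w | X w <= a / 2] in E2.
have -> : q11 * (- tau * a - delta + a / 2 * (1 + 1)) +
  q10 * (- tau * a - delta + a / 2 * (1 + 0)) +
  (q01 * (- tau * a - delta + a / 2 * (0 + 1)) +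
  q00 * (- tau * a - delta + a / 2 * (0 + 0))) =
  (- tau * a - delta) * (q11 + q10 + (q01 + q00)) +
  a / 2 * ((q11 + q10) + (q11 + q01)) by ring.
rewrite -E0 -E1 -E2 F0.
suff : m * mm <= a / 2 * (G - tau) by lra.
have c1 : m <= f / 4 by rewrite /m ge_min lexx.
have c2 : m <= f * L / 2 by rewrite /m ge_min lexx orbT.
have m0 : 0 <= m by rewrite /m le_min; apply/andP; split; nra.
have mm1 : mm <= `|a| by rewrite /mm ge_min lexx.
have mm2 : mm <= a ^+ 2 by rewrite /mm ge_min lexx orbT.
(* Within range, growth at [a / 2] gives a quadratic bound. Otherwise growth at [L] or [- L] and
   monotonicity of the distribution function give a linear one. *)
case: (lerP `|a / 2| L) => aL.
  have := growth _ aL; rewrite -/G F0.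
  case: (lerP 0 a) => a0.
    have a2 : 0 <= a / 2 by lra.
    have := monoF _ _ a2; rewrite F0 -/G => FG.
    rewrite !ger0_norm ?subr_ge0 // => gr.
    have : m * mm <= f / 4 * a ^+ 2.
      by apply: le_trans (ler_wpM2l m0 mm2) _; apply: ler_wpM2r; rewrite ?sqr_ge0.
    have := ler_wpM2l a2 gr; lra.
  have a2 : a / 2 <= 0 by lra.
  have := monoF _ _ a2; rewrite F0 -/G => FG.
  rewrite !ler0_norm ?subr_le0 // => gr.
  have : m * mm <= f / 4 * a ^+ 2.
    by apply: le_trans (ler_wpM2l m0 mm2) _; apply: ler_wpM2r; rewrite ?sqr_ge0.
  have a2' : 0 <= - (a / 2) by lra.
  have := ler_wpM2l a2' gr; lra.
have mL : m * mm <= f * L / 2 * `|a|.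
  by apply: le_trans (ler_wpM2l m0 mm1) _; apply: ler_wpM2r.
have := growth L; have := growth (- L).
rewrite normrN (ger0_norm (ltW L0)) lexx => /(_ isT) g1 /(_ isT) g2.
case: (lerP 0 a) => a0.
  move: aL mL; rewrite !ger0_norm //; last by lra. move=> aL mL.
  have h1 := monoF _ _ (ltW L0); have h2 := monoF _ _ (ltW aL).
  move: g2; rewrite ger0_norm ?subr_ge0 // F0 => g2.
  have a2 : 0 <= a / 2 by lra.
  have g3 : f * L <= G - tau by rewrite /G; lra.
  have := ler_wpM2l a2 g3; lra.
move: aL mL; rewrite !ler0_norm; [|lra|lra]. move=> aL mL.
have NL0 : - L <= 0 by lra.
have aNL : a / 2 <= - L by lra.
have h1 := monoF _ _ NL0; have h2 := monoF _ _ aNL.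
move: g1; rewrite ler0_norm ?subr_le0 // F0 => g1.
have a2 : 0 <= - (a / 2) by lra.
have g3 : f * L <= tau - G by rewrite /G; lra.
have := ler_wpM2l a2 g3; lra.
Qed.

End finite_laws.

(** * From the empirical process to the estimator *)

(* Markov's inequality for the supremum of the empirical process. The supremum
   runs over one witness per bad pattern of the discretized data, hence over a
   finite family. *)
Lemma bad_event_bound (d : measure_display) (T : measurableType d)
    (R : realType) (P : probability T R) (n : nat) (y : 'I_n -> {RV P >-> R})
    (K : finType) (g : 'I_n -> R -> K) (c : 'I_n -> K -> R -> R)
    (C : set 'rV[R]_n) (eps t : R) (bad : set T) :
  mutually_independent y ->
  (forall i k, measurable (g i @^-1` [set k])) ->
  (forall i k l s u, (c i l s - c i k s) - (c i l u - c i k u) <= `|s - u|) ->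
  (forall i k, c i k 0 = 0) ->
  0 < t -> 0 <= eps -> C 0 ->
  (forall (S : finType) (s0 : S) (x : S -> 'rV[R]_n), (forall s, C (x s)) ->
     Eprod (@rademacher R _) (fun e => fmax s0 (fun s =>
        \sum_i sgn R (e i) * x s 0 i)) <= eps * t) ->
  (forall w, bad w -> exists v, C v /\
     t <= \sum_i (\sum_k pr P [set w' | g i (y i w') = k] * c i k (v 0 i) -
                  c i (g i (y i w)) (v 0 i))) ->
  exists B, [/\ measurable B, bad `<=` B & (P B <= eps%:E)%E].
Proof.
move=> indep mg clip c0 t0 eps0 C0 width badw.
(* A point [w0] is needed so that the finite type of patterns is inhabited for [fmax]. *)
have [->|/set0P[w0 _]] := eqVneq bad set0.
  by exists set0; split=> //; rewrite measure0 lee_fin.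
pose p i k := pr P [set w' | g i (y i w') = k].
have mfib i k : measurable [set w' | g i (y i w') = k].
  have := measurable_funP (y i) measurableT _ (mg i k).
  by rewrite setTI.
have pp : pmf_family p.
  split=> [i k|i]; first exact: pr_ge0.
  rewrite -(prT P) (pr_fibers P (g := fun w => g i (y i w))) //.
    by apply: eq_bigr => k _; rewrite setTI.
  by move=> k; exact: mfib.
pose pat w : {ffun 'I_n -> K} := [ffun i => g i (y i w)].
pose Bd k := `[< exists w, bad w /\ pat w = k >].
pose Z (k : {ffun 'I_n -> K}) (v : 'rV[R]_n) :=
  \sum_i (\sum_l p i l * c i l (v 0 i) - c i (k i) (v 0 i)).
(* The process depends on [w] only through its pattern, so one witness per bad pattern suffices. The
   other patterns receive the zero vector, where the process vanishes. *)
have [x hx] : exists x : {ffun 'I_n -> K} -> 'rV[R]_n,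
    forall k, C (x k) /\ (if Bd k then t else 0) <= Z k (x k).
  suff h k : exists v, C v /\ (if Bd k then t else 0) <= Z k v.
    by have [x hx] := choice h; exists x.
  rewrite /Bd; case: asboolP => [[w [bw <-]]|_].
    have [v [Cv tv]] := badw w bw; exists v; split=> //.
    by apply: le_trans tv _; apply: ler_sum => i _; rewrite /pat ffunE.
  exists 0; split=> //; rewrite /Z big1 // => i _.
  by rewrite mxE big1 ?c0 ?subrr // => l _; rewrite c0 mulr0.
have patE k : pat @^-1` [set k] =
    \bigcap_(i in [set: 'I_n]) (y i @^-1` (g i @^-1` [set k i])).
  apply/seteqP; split=> w /=.
    by move=> <- i _ /=; rewrite ffunE.
  by move=> h; apply/ffunP => i; rewrite ffunE; exact: (h i I).
have mpat k : measurable (pat @^-1` [set k]).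
  rewrite patE; apply: fin_bigcap_measurable => // i _; exact: mfib.
have prpat k : pr P (pat @^-1` [set k]) = \prod_i p i (k i).
  apply: EFin_inj; rewrite -prE // patE indep // -prodEFin.
  by apply: eq_bigr => i _; rewrite prE //; exact: mfib.
(* A finite union of fibers, measurable even if [bad] is not. *)
pose B := \bigcup_(k in [set k | Bd k]) (pat @^-1` [set k]).
exists B; split.
- by apply: fin_bigcup_measurable => // k _.
- by move=> w bw; exists (pat w) => //=; apply/asboolP; exists w.
have mB : measurable B by apply: fin_bigcup_measurable => // k _.
rewrite prE // lee_fin -(ler_pM2r t0).
have -> : pr P B = \sum_(k | Bd k) \prod_i p i (k i).
  rewrite /B pr_bigcup //; first by apply: eq_bigr => k _; rewrite prpat.
  by move=> k l _ _ [w [/= <- <-]].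
apply: le_trans (width _ (pat w0) x (fun k => (hx k).1)).
apply: le_trans (symmetrization_contraction (pat w0)
  (phi := fun i k s => c i k (x s 0 i)) (x := fun i s => x s 0 i) pp _); last first.
  by move=> *; exact: clip.
rewrite mulr_suml /Eprod big_mkcond /=; apply: ler_sum => k _.
have := (hx k).2; have := fmax_ge (pat w0) (fun s => Z k (x s)) k.
have w0k : 0 <= \prod_i p i (k i) by apply: prodr_ge0 => i _; exact: pr_ge0.
rewrite -/(Z k _) /= => h1 h2.
have := le_trans h2 h1; case: ifP => _ h3.
  exact: ler_wpM2l.
by rewrite mulr_ge0.
Qed.

Definition huber_sum (R : realType) (n : nat) (v : 'rV[R]_n) : R :=
  \sum_i Num.min `|v 0 i| (v 0 i ^+ 2).

Lemma huber_sum_ge0 (R : realType) (n : nat) (v : 'rV[R]_n) : 0 <= huber_sum v.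
Proof. by apply: sumr_ge0 => i _; rewrite le_min normr_ge0 sqr_ge0. Qed.

Lemma huber_sum_path_continuous (R : realType) (n : nat) (v : 'rV[R]_n) :
  continuous (fun a : R => huber_sum (a *: v)).
Proof.
rewrite (_ : (fun a => _) =
  fun a => \sum_(i < n) Num.min `|a * v 0 i| ((a * v 0 i) ^+ 2)); last first.
  by apply/funext => a; apply: eq_bigr => i _; rewrite mxE.
apply: continuous_big => [|i _ a].
  exact: add_continuous.
have ca : {for a, continuous (fun a : R => a * v 0 i)}.
  by apply: continuousM; [exact: cvg_id|exact: cvg_cst].
apply: (@continuous_min R R (fun a => `|a * v 0 i|) (fun a => (a * v 0 i) ^+ 2)).
  by apply: continuous_comp ca _; exact: norm_continuous.
by apply: (@continuous_comp _ _ _ _ (fun z : R => z ^+ 2)) ca _;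
  exact: exprn_continuous.
Qed.

(* By convexity of the objective, a large deviation of a minimizer can be
   shrunk to one of prescribed size B that still beats the true vector. *)
Lemma shrink_deviation (R : realType) (tau : R) (r n : nat) (lambda c0 B : R)
    (y th v : 'rV[R]_n) :
  0 <= lambda -> 0 <= B ->
  qtf_objective tau r lambda y (th + v) <= qtf_objective tau r lambda y th ->
  B <= c0 * huber_sum v + lambda * trend_variation r v ->
  exists v', c0 * huber_sum v' + lambda * trend_variation r v' = B /\
    \sum_i loss_diff tau (y 0 i - th 0 i) (v' 0 i) +
      lambda * trend_variation r v' <= 2 * (lambda * trend_variation r th).
Proof.
move=> l0 B0 opt BG.
pose G (a : R) := c0 * huber_sum (a *: v) + lambda * trend_variation r (a *: v).
have G0 : G 0 = 0.
  rewrite /G trend_variationZ normr0 mul0r mulr0 addr0 scale0r.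
  rewrite /huber_sum big1 ?mulr0 // => i _.
  by rewrite mxE normr0 expr0n /= minxx.
have cTV : continuous (fun a : R => trend_variation r (a *: v)).
  rewrite (_ : (fun a : R => _) = fun a => `|a| * trend_variation r v).
    by move=> a; apply: cvgM; [exact: norm_continuous|exact: cvg_cst].
  by apply/funext => b; rewrite trend_variationZ.
have cG : continuous G.
  move=> a; apply: cvgD; apply: cvgM; try exact: cvg_cst.
    exact: huber_sum_path_continuous.
  exact: cTV.
have G1 : G 1 = c0 * huber_sum v + lambda * trend_variation r v.
  by rewrite /G scale1r.
(* The size [G] is not homogeneous in [a], so the scaling factor comes from the intermediate value
   theorem. *)
have [a] : exists2 a, a \in `[0, 1] & G a = B.
  apply: IVT => //; first exact: continuous_subspaceT.
  by rewrite G0 G1 ge_min le_max B0 BG orbT.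
rewrite in_itv /= => a01 Ga; exists (a *: v); split=> //.
have /andP[a0 a1] := a01.
have tv1 : trend_variation r (th + a *: v) <=
    (1 - a) * trend_variation r th + a * trend_variation r (th + v).
  rewrite (_ : th + a *: v = (1 - a) *: th + a *: (th + v)).
    apply: le_trans (trend_variationD _ _ _) _.
    by rewrite !trend_variationZ !ger0_norm // subr_ge0.
  by rewrite scalerDr addrA -scalerDl subrK scale1r.
have tv2 : trend_variation r (a *: v) <=
    trend_variation r (th + a *: v) + trend_variation r th.
  have {1}-> : a *: v = (th + a *: v) + (-1) *: th.
    by rewrite scaleN1r addrAC subrr add0r.
  apply: le_trans (trend_variationD _ _ _) _.
  by rewrite trend_variationZ normrN1 mul1r.
have cvx : \sum_i loss_diff tau (y 0 i - th 0 i) ((a *: v) 0 i) <=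
    a * \sum_i loss_diff tau (y 0 i - th 0 i) (v 0 i).
  rewrite mulr_sumr; apply: ler_sum => i _; rewrite mxE.
  exact: check_loss_convex.
have opt2 : \sum_i loss_diff tau (y 0 i - th 0 i) (v 0 i) <=
    lambda * (trend_variation r th - trend_variation r (th + v)).
  move: opt; rewrite /qtf_objective /loss_diff sumrB.
  under eq_bigr do rewrite mxE opprD addrA.
  by lra.
(* The multiples of [trend_variation r (th + v)] from optimality and from convexity cancel, leaving
   twice the penalty of [th]. *)
have h1 := ler_wpM2l a0 opt2.
have h2 := ler_wpM2l l0 tv1.
have h3 := ler_wpM2l l0 tv2.
by nra.
Qed.

(** The block length [l] is about [n / X], so there are at most [3 * X] blocks, each with [r.+1]
    monomials. The relation defining [X] balances this dimension against the width of the atoms. *)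
Lemma trend_width (R : realType) (S : finType) (s0 : S) (r n : nat)
    (x : S -> 'rV[R]_n) (X D W a : R) :
  (r.+1 < n)%N -> 1 <= ln (n%:R : R) -> 1 <= X -> X <= n%:R ->
  X ^+ (2 * r).+3 = n%:R * ln n%:R -> 0 <= D -> 0 < a ->
  (forall s, trend_variation r.+1 (x s) <= D) ->
  (forall s, \sum_i x s 0 i ^+ 2 <= W) ->
  Eprod (@rademacher R _) (fun e => fmax s0 (fun s =>
      \sum_i sgn R (e i) * x s 0 i)) <=
  2^-1 * (a * W + a^-1 * (3 * r.+1%:R * X)) + 5 * D * X.
Proof.
move=> rn ln1 X1 Xn XE D0 a0 xD xW.
have n0 : (0 : R) < n%:R by rewrite ltr0n (leq_trans _ rn).
have X0 : 0 < X by lra.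
have X00 : X != 0 by rewrite gt_eqF.
have n00 : n%:R != 0 :> R by rewrite gt_eqF.
have nX0 : 0 <= n%:R / X by rewrite divr_ge0 // ltW.
pose l := Num.trunc (n%:R / X).
have /andP[l1 l2] := truncn_itv nX0.
rewrite -/l in l1 l2.
have lp : (0 < l)%N by rewrite truncn_gt0 ler_pdivlMr // mul1r.
have lR : (1 : R) <= l%:R by rewrite ler1n.
have nl : n%:R <= 2 * X * l%:R.
  move: l2; rewrite ltr_pdivrMr // -natr1 => l2.
  by nra.
have [A [Q [dec hQ]]] := block_decomposition R r n lp.
have k_le : ((n %/ l).+1 * r.+1)%:R <= 3 * r.+1%:R * X.
  rewrite natrM -[_.+1%:R in leLHS]natr1 -mulrA [_ * X]mulrC mulrA.
  rewrite ler_wpM2r ?ler0n //.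
  have : (n %/ l)%:R * l%:R <= n%:R :> R by rewrite -natrM ler_nat leq_trunc_div.
  move=> /le_trans /(_ nl); rewrite ler_pM2r; last by lra.
  lra.
(* This choice makes [s ^+ 2 * (n%:R / X) ^+ (2 * r).+1] equal to [ln n%:R]. *)
pose s := ln (n%:R : R) / (X * n%:R ^+ r).
have nr0 : (0 : R) < n%:R ^+ r by rewrite exprn_gt0.
have sp : 0 < s by rewrite divr_gt0 ?mulr_gt0 //; lra.
have N0 : (0 < n - r.+1)%N by rewrite subn_gt0.
have xdec t : exists (c : 'rV_((n %/ l).+1 * r.+1)) (w : 'rV_(n - r.+1)),
     x t = c *m A + w *m Q /\ \sum_j `|w 0 j| <= D / n%:R ^+ r.
  have [c xE] := dec (x t); exists c; eexists; split; first exact: xE.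
  rewrite ler_pdivlMr // mulrC; apply: le_trans (xD t).
  rewrite trend_variationE ler_pM2l //; apply: ler_sum => j _.
  by rewrite mxE.
have D'0 : 0 <= D / n%:R ^+ r by rewrite divr_ge0 // ltW.
apply: le_trans (rademacher_width s0 N0 a0 sp D'0 hQ xW xdec) _.
apply: lerD.
  by rewrite ler_pM2l // lerD2l ler_pM2l // invr_gt0.
have lnN : ln (n - r.+1)%:R <= ln n%:R :> R.
  by rewrite ler_ln ?posrE ?ler_nat ?leq_subr // ltr0n.
have lpow : l%:R ^+ (2 * r).+1 <= (n%:R / X) ^+ (2 * r).+1.
  by rewrite lerXn2r ?nnegrE // ler0n.
have sinv : 0 <= s^-1 by rewrite invr_ge0 ltW.
(* The factor 3 absorbs [ln N] and the additive 2, since [ln n%:R] is at least 1. *)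
apply: (@le_trans _ _ (D / n%:R ^+ r * (s^-1 * (3 * ln n%:R +
    2 * s ^+ 2 * (n%:R / X) ^+ (2 * r).+1)))).
  rewrite ler_wpM2l // ler_wpM2l //.
  have s2 : 0 <= 2 * s ^+ 2 by rewrite mulr_ge0 ?sqr_ge0.
  by have := ler_wpM2l s2 lpow; lra.
have lnE : ln n%:R = X ^+ (2 * r).+3 / n%:R by rewrite XE mulrC mulKf.
have -> : D / n%:R ^+ r * (s^-1 * (3 * ln n%:R +
    2 * s ^+ 2 * (n%:R / X) ^+ (2 * r).+1)) = 5 * D * X.
  rewrite /s lnE !expr_div_n !exprS ?expr0 (mulnC 2%N) !exprM.
  move: (gt_eqF nr0) (exprn_gt0 r X0); set u := n%:R ^+ r; set v := X ^+ r => u0 v0.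
  by field; rewrite u0 X00 n00 gt_eqF.
by [].
Qed.

(** * Asymptotics of the rate *)

Lemma qtf_rate_pow (R : realType) (m : nat) (x : R) : (0 < m)%N ->
  0 <= x -> 0 <= ln x -> (x `^ m%:R^-1 * ln x `^ m%:R^-1) ^+ m = x * ln x.
Proof.
move=> m0 x0 lx0; rewrite -powRM // -powR_mulrn ?powR_ge0 // -powRrM mulVf.
  by rewrite powRr1 // mulr_ge0.
by rewrite pnatr_eq0 -lt0n.
Qed.

Lemma qtf_rate_target (R : realType) (r : nat) (x : R) : 0 < x ->
  x `^ (- ((2 * r)%:R / (2 * r + 1)%:R)) = x `^ (2 * r + 1)%:R^-1 / x.
Proof.
move=> x0.
have q0 : (2 * r + 1)%:R != 0 :> R by rewrite pnatr_eq0; lia.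
have -> : - ((2 * r)%:R / (2 * r + 1)%:R) = (2 * r + 1)%:R^-1 - 1 :> R.
  by move: q0; rewrite natrD => q0; field.
rewrite powRD ?(gt_eqF x0) ?implybT // powR_inv1 // ltW //.
Qed.

(** Apply [ln q <= q - 1] to the square root [q] of [n]; the threshold ensures [2 <= eta * q]. *)
Lemma ln_sublinear (R : realType) (eta : R) : 0 < eta ->
  exists n0, forall n, (n0 <= n)%N -> ln (n%:R : R) <= eta * n%:R.
Proof.
move=> e0; pose n0 := (Num.trunc (4 / eta ^+ 2)).+1; exists n0 => n hn.
have e2 : 0 < eta ^+ 2 by rewrite exprn_gt0.
have n4 : 4 / eta ^+ 2 <= n%:R.
  have /andP[_ /ltW/le_trans] := truncn_itv (divr_ge0 (ler0n R 4) (ltW e2)).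
  by apply; rewrite ler_nat.
have np : 0 < n%:R :> R by apply: lt_le_trans n4; rewrite divr_gt0.
pose q := Num.sqrt (n%:R : R).
have q0 : 0 < q by rewrite sqrtr_gt0.
have qn : q ^+ 2 = n%:R by rewrite sqr_sqrtr // ltW.
have lq : ln q <= q - 1.
  by have := @le_ln1Dx R (q - 1); rewrite (_ : 1 + (q - 1) = q); [apply; lra|ring].
rewrite -qn lnXn // mulr2n.
have eq2 : 2 <= eta * q.
  move: n4; rewrite ler_pdivrMr // -qn -exprMn mulrC => n4.
  have eq0 : 0 < eta * q by rewrite mulr_gt0.
  rewrite leNgt; apply/negP => lt2; move: n4; rewrite expr2; nra.
rewrite expr2 mulrA; nra.
Qed.

(** With [m = 2 * r.+1 + 1], the [m]-th power of the rate is [n * ln n], at most [eta ^ m * n ^ 2]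
    for large [n], hence at most [(eta * n) ^ m]. *)
Lemma qtf_rate_small (R : realType) (r : nat) (eta : R) : 0 < eta ->
  exists n0, forall n, (n0 <= n)%N ->
    [/\ 1 <= ln (n%:R : R),
        1 <= n%:R `^ (2 * r.+1 + 1)%:R^-1 * ln n%:R `^ (2 * r.+1 + 1)%:R^-1 :> R &
        n%:R `^ (2 * r.+1 + 1)%:R^-1 * ln n%:R `^ (2 * r.+1 + 1)%:R^-1
          <= eta * n%:R :> R].
Proof.
move=> e0; have [n1 h1] := @ln_sublinear R (eta ^+ (2 * r.+1 + 1)) (exprn_gt0 _ e0).
pose n2 := (Num.trunc (expR 1 : R)).+1.
exists (maxn n1 n2) => n; rewrite geq_max => /andP[hn1 hn2].
have en : expR 1 <= n%:R :> R.
  have /andP[_ /ltW/le_trans] := truncn_itv (expR_ge0 (1 : R)).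
  by apply; rewrite ler_nat.
have np : 0 < n%:R :> R by apply: lt_le_trans en; exact: expR_gt0.
have n1R : 1 <= n%:R :> R by rewrite ler1n -(ltr0n R).
have ln1 : 1 <= ln n%:R :> R.
  by rewrite -ler_expR lnK ?posrE.
have ln0 : 0 <= ln n%:R :> R by lra.
have q0 : (0 < 2 * r.+1 + 1)%N by lia.
have XE := qtf_rate_pow q0 (ltW np) ln0.
set X := _ * _ in XE *.
have X0 : 0 <= X by rewrite mulr_ge0 ?powR_ge0.
split=> //.
  rewrite -(ler_pXn2r q0) ?nnegrE // expr1n XE; nra.
have en0 : 0 <= eta * n%:R by rewrite mulr_ge0 // ltW.
rewrite -(ler_pXn2r q0) ?nnegrE // XE exprMn.
apply: (@le_trans _ _ (n%:R * (eta ^+ (2 * r.+1 + 1) * n%:R))).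
  by rewrite ler_pM2l // h1.
rewrite mulrCA ler_pM2l ?exprn_gt0 // addn1 exprS ler_pM2l //.
by rewrite -[leLHS]expr1 ler_weXn2l.
Qed.

Lemma theta_one_bounds (R : realType) (V : nat -> R) :
  V \is 'Theta_\oo (fun _ : nat => 1 : R) ->
  exists (V1 V2 : R) (n0 : nat), [/\ 0 < V1, 0 < V2 &
    forall n, (n0 <= n)%N -> 0 <= V n -> V1 <= V n <= V2].
Proof.
move=> /asboolP[[V1 V2] /= /andP[V10 V20]] [n0 _ h].
exists V1, V2, n0; split=> // n nn Vn0.
have := h n nn; rewrite normr1 !mulr1 ger0_norm //.
by move=> [-> ->].
Qed.

(** For [0 <= z <= C] and [1 <= C], [z ^+ 2] is at most [C] times the minimum of [z] and [z ^+ 2].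
    This turns the uniform bound into the Euclidean bound required by [trend_width]. *)
Lemma huber_sum_sq (R : realType) (n : nat) (v : 'rV[R]_n) (C : R) :
  1 <= C -> (forall i, `|v 0 i| <= C) ->
  \sum_i v 0 i ^+ 2 <= C * huber_sum v.
Proof.
move=> C1 vC; rewrite mulr_sumr; apply: ler_sum => i _.
rewrite -real_normK ?num_real //; have := vC i; have := normr_ge0 (v 0 i).
move: `|_| => z z0 zC; case: (leP z (z ^+ 2)) => h; first by rewrite expr2; nra.
by nra.
Qed.

Lemma measurable_delta_sq (d : measure_display) (T : measurableType d)
    (R : realType) (P : probability T R) (n : nat) (X : 'I_n -> {RV P >-> R})
    (theta : 'rV[R]_n) (b : R) :
  measurable [set w | delta_sq (random_row X w - theta) <= b].
Proof.
rewrite -[X in measurable X]setTI; apply: measurable_fun_le => //.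
rewrite (_ : (fun w => _) = fun w => n%:R^-1 *
  \sum_(i < n) Num.min `|X i w - theta 0 i| ((X i w - theta 0 i) ^+ 2)); last first.
  by apply/funext => w; congr (_ * _); apply: eq_bigr => i _; rewrite !mxE.
apply: measurable_funM => //; apply: measurable_sum => i.
have mX : measurable_fun setT (fun w => X i w - theta 0 i).
  by apply: measurable_funB.
apply: measurable_minr.
  exact: measurableT_comp.
exact: measurable_funX.
Qed.

Definition deviation_ball (R : realType) (r n : nat) (c0 lambda b : R)
    (v : 'rV[R]_n) : Prop :=
  c0 * huber_sum v + lambda * trend_variation r v <= b.

(** Above the threshold, the shrunk vector has size [4 * t] while its empirical loss plus penalty is
    at most [2 * t]. Its expected loss is at least [c0 * huber_sum v] up to rounding, so the centred
    process reaches [t]. *)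
Lemma large_deviation_bound (R : realType) (tau : R) (r n : nat)
    (d : measure_display) (T : measurableType d) (P : probability T R)
    (y : 'I_n -> {RV P >-> R}) (theta : 'rV[R]_n)
    (theta_hat : 'I_n -> {RV P >-> R}) (L f lambda V t C eps : R) :
  let c0 := Num.min (f / 4) (f * L / 2) in
  0 < tau < 1 -> 0 < L -> 0 < f -> 0 < eps -> (0 < n)%N -> 0 <= C ->
  0 < lambda -> trend_variation r theta = V -> t = lambda * V -> 0 < t ->
  mutually_independent y ->
  (forall i, cdf (y i) (theta 0 i) = tau%:E) ->
  cdf_growth y theta L f ->
  is_qtf_estimator tau r lambda y theta_hat ->
  (forall v : 'rV[R]_n, deviation_ball r c0 lambda (4 * t) v ->
     forall i, `|v 0 i| <= C) ->
  (forall (S : finType) (s0 : S) (x : S -> 'rV[R]_n),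
     (forall s, deviation_ball r c0 lambda (4 * t) (x s)) ->
     Eprod (@rademacher R _) (fun e => fmax s0 (fun s =>
        \sum_i sgn R (e i) * x s 0 i)) <= eps * t) ->
  exists B, [/\ measurable B,
    [set w | 4 * t < c0 * huber_sum (random_row theta_hat w - theta)] `<=` B &
    (P B <= eps%:E)%E].
Proof.
move=> c0 htau L0 f0 eps0 n0 C0 lam0 tvE tE t0 indep hcdf growth est supK width.
pose K : set 'rV[R]_n := deviation_ball r c0 lambda (4 * t).
have tau01 : 0 <= tau <= 1 by case/andP: htau => *; apply/andP; split; lra.
have nR : (0 : R) < n%:R by rewrite ltr0n.
(* Rounding is paid twice, in the expected and in the empirical loss, at [t / 2] each;
   [4 * t - 2 * t - t] leaves the level [t]. *)
pose delta := t / (2 * n%:R).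
have d0 : 0 < delta by rewrite divr_gt0 // mulr_gt0.
have [N [g0 [rep [mg0 grep]]]] := loss_discretization tau01 C0 d0.
pose g (i : 'I_n) (x : R) := g0 (x - theta 0 i).
have mg i k : measurable (g i @^-1` [set k]).
  have mB : measurable_fun setT (fun x : R => x - theta 0 i).
    exact: measurable_funB.
  by have := mB measurableT _ (mg0 k); rewrite setTI.
pose c (i : 'I_n) (k : 'I_N.+1) (a : R) := loss_diff tau (rep k) a.
have K0 : K 0.
  rewrite /K /deviation_ball /= /huber_sum big1 => [|i _]; last first.
    by rewrite mxE normr0 expr0n /= minxx.
  have -> : trend_variation r (0 : 'rV[R]_n) = 0.
    by rewrite -(scale0r theta) trend_variationZ normr0 mul0r.
  by rewrite !mulr0 addr0 mulr_ge0 // ltW.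
apply: (bad_event_bound (c := c) (C := K) (t := t) indep mg) => //.
- by move=> i k l s u; rewrite /c; exact: loss_diff_lip2.
- by move=> i k; exact: loss_diff0.
- exact: ltW.
move=> w /= big_w.
have [v [vB vloss]] : exists v',
    c0 * huber_sum v' + lambda * trend_variation r v' = 4 * t /\
    \sum_i loss_diff tau (random_row y w 0 i - theta 0 i) (v' 0 i) +
      lambda * trend_variation r v' <= 2 * t.
  rewrite tE -tvE.
  apply: (@shrink_deviation _ _ _ _ _ _ _ _ _
    (random_row theta_hat w - theta)).
  - exact: ltW.
  - by rewrite tvE -tE mulr_ge0 // ltW.
  - by rewrite addrC subrK; exact: est.
  - have : 0 <= lambda * trend_variation r (random_row theta_hat w - theta).
      by rewrite mulr_ge0 ?trend_variation_ge0 // ltW.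
    by rewrite tvE -tE; move: big_w; lra.
have Kv : K v by rewrite /K /deviation_ball /= vB.
exists v; split=> //.
have vC := supK v Kv.
have expect i : c0 * Num.min `|v 0 i| (v 0 i ^+ 2) - delta <=
    \sum_k pr P [set w' | g i (y i w') = k] * c i k (v 0 i).
  pose X w' := y i w' - theta 0 i.
  have mX : measurable_fun setT X by exact: measurable_funB.
  have cdfE b : pr P [set w' | X w' <= b] = fine (cdf (y i) (theta 0 i + b)).
    rewrite /pr /cdf /distribution /pushforward; congr (fine (P _)).
    apply/seteqP; split=> w' /=; rewrite in_itv /= /X; lra.
  apply: (@expected_loss_ge _ _ _ P tau (v 0 i) delta L f X _
    (fun w' => g i (y i w'))) => //.
  - move=> k; have mfib := measurable_funP (y i) measurableT _ (mg i k).
    by rewrite setTI in mfib.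
  - move=> w'; rewrite /c /g -/(X w').
    by have := grep (X w') _ (vC i); rewrite ler_norml => /andP[_]; lra.
  - by rewrite cdfE addr0 hcdf.
  - move=> b bL; rewrite !cdfE addr0.
    (* Assumption A speaks of vectors; a constant vector gives its scalar form. *)
    have hdelta (j : 'I_n) : `|(\row_(j < n) b) 0 j| <= L by rewrite mxE.
    have := growth _ hdelta i; rewrite mxE hcdf.
    have -> : cdf (y i) (theta 0 i + b) = (fine (cdf (y i) (theta 0 i + b)))%:E.
      rewrite fineK // /cdf /distribution /pushforward.
      apply: fin_num_measure; rewrite -[X in measurable X]setTI.
      exact: measurable_funP.
    by rewrite -EFinB /= lee_fin.
have sum_expect : c0 * huber_sum v - n%:R * delta <=
    \sum_i \sum_k pr P [set w' | g i (y i w') = k] * c i k (v 0 i).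
  have := ler_sum (index_enum 'I_n) (P := xpredT) (fun i _ => expect i).
  rewrite sumrB -mulr_sumr sumr_const card_ord mulr_natl.
  exact.
have sum_emp : \sum_i c i (g i (y i w)) (v 0 i) <=
    \sum_i loss_diff tau (random_row y w 0 i - theta 0 i) (v 0 i) + n%:R * delta.
  have -> : n%:R * delta = \sum_(i < n) delta.
    by rewrite sumr_const card_ord mulr_natl.
  rewrite -big_split /=; apply: ler_sum => i _; rewrite /c /g mxE.
  have := grep (y i w - theta 0 i) _ (vC i).
  by rewrite ler_norml => /andP[h _]; lra.
have nd : n%:R * delta = t / 2 by rewrite /delta; field; rewrite gt_eqF.
rewrite sumrB; lra.
Qed.

Theorem theorem3 (R : realType) (tau : R) (r : nat) (L f : R) (V : nat -> R)
  (htau : 0 < tau < 1) (hr : (1 <= r)%N) (hL : 0 < L) (hf : 0 < f)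
  (hV : V \is 'Theta_\oo (fun _ : nat => 1 : R))
  (eps : R) (heps : 0 < eps < 1) :
  exists c1 : R, 0 < c1 /\
  forall c : R, c1 < c ->
  exists c2 : R, 0 < c2 /\
  exists n0 : nat,
  forall (n : nat) (d : measure_display) (T : measurableType d)
         (P : probability T R) (y : 'I_n -> {RV P >-> R})
         (theta : 'rV[R]_n) (theta_hat : 'I_n -> {RV P >-> R}),
  (n0 <= n)%N ->
  mutually_independent y ->
  (forall i, minimizes_expected_check_loss tau (y i) (theta 0 i)) ->
  (forall i, cdf (y i) (theta 0 i) = tau%:E) ->
  cdf_growth y theta L f ->
  trend_variation r theta = V n ->
  is_qtf_estimator tau r
    (c * n%:R `^ (2 * r + 1)%:R^-1 * ln n%:R `^ (2 * r + 1)%:R^-1)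
    y theta_hat ->
  ((1 - eps)%:E <=
   P [set w | (delta_sq (random_row theta_hat w - theta) <=
               c2 * n%:R `^ (- ((2 * r)%:R / (2 * r + 1)%:R))
                  * ln n%:R `^ (2 * r + 1)%:R^-1)%R])%E.
Proof.
(* From here the order is [r.+1], and the local polynomials have degree at most [r]. *)
case: r hr => // r _.
have /andP[eps0 eps1] := heps.
have [V1 [V2 [nV [V10 V20 Vb]]]] := theta_one_bounds hV.
pose c0 := Num.min (f / 4) (f * L / 2).
have c00 : 0 < c0 by rewrite /c0 lt_min !divr_gt0 // mulr_gt0.
(* Deviations in the ball of size [4 * t] have trend variation at most [4 * V n]. *)
pose C := sup_const r (4 * V2).
have q4 : 1 <= (4 * r.+1)%:R ^+ r :> R by rewrite exprn_ege1 // ler1n.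
have C1 : 1 <= C.
  rewrite /C /sup_const.
  have : 1 <= r.+1%:R :> R by rewrite ler1n.
  move: q4; set u := _ ^+ r; set v := r.+1%:R => u1 v1.
  have : 1 <= (1 + 4 * V2) * u by nra.
  by nra.
pose a := eps * c0 / (8 * C).
have a0 : 0 < a by rewrite divr_gt0 ?mulr_gt0 //; lra.
(* The width bound splits as eps t / 4 + eps t / 4 + eps t / 2; the choice of a
   settles the first term, the two summands of c1 the other two. *)
pose c1 := 48 * r.+1%:R * C / (eps ^+ 2 * c0 * V1) + 40 / eps.
have r1 : 0 < r.+1%:R :> R by rewrite ltr0n.
have C0 : 0 < C by lra.
have cA0 : 0 < 48 * r.+1%:R * C / (eps ^+ 2 * c0 * V1).
  by rewrite divr_gt0 // !mulr_gt0 // exprn_gt0.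
have cB0 : 0 < 40 / eps by rewrite divr_gt0.
exists c1; split; first by rewrite addr_gt0.
move=> c cc1; have cpos : 0 < c by rewrite /c1 in cc1; lra.
exists (4 * c * V2 / c0); split; first by rewrite divr_gt0 // !mulr_gt0.
(* The first entry gives [X <= n]; the second keeps [4 * t / c0] below the number of indices in a
   window of [sup_bound]. *)
pose eta := Num.min 1 (c0 / (32 * r.+1%:R * c * V2)).
have eta0 : 0 < eta by rewrite /eta lt_min ltr01 divr_gt0 // !mulr_gt0.
have [nX hX] := @qtf_rate_small R r eta eta0.
exists (maxn (maxn nV nX) (2 * r.+1)).+1.
move=> n d T P y theta theta_hat nn indep _ hcdf growth tvV est.
have := ltnW nn; rewrite !geq_max => /andP[/andP[nnV nnX] nr].
have r_n : (r.+1 < n)%N.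
  by apply: leq_ltn_trans nn; rewrite !leq_max leq_pmull ?orbT.
have n_pos : (0 < n)%N by apply: leq_ltn_trans r_n.
have nR : (0 : R) < n%:R by rewrite ltr0n.
have [ln1 X1 Xeta] := hX n nnX.
have q0 : (0 < 2 * r.+1 + 1)%N by rewrite addn1.
have XE := qtf_rate_pow q0 (ltW nR) (le_trans ler01 ln1).
move: est; rewrite -[c * _ * _]mulrA (qtf_rate_target _ nR).
have rateE (k u w : R) : k * (u / n%:R) * w = k * (u * w / n%:R) by ring.
rewrite rateE.
move: X1 Xeta XE; set X := _ `^ _ * _ `^ _ => X1 Xeta XE est.
clearbody X.
have Xn : X <= n%:R.
  apply: le_trans Xeta _; apply: ler_piMl; first exact: ltW.
  by rewrite /eta ge_min lexx.
have X0 : 0 < X by lra.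
have tv0 : 0 <= V n by rewrite -tvV trend_variation_ge0.
have /andP[VV1 VV2] := Vb n nnV tv0.
have Vp : 0 < V n by lra.
have lam0 : 0 < c * X by rewrite mulr_gt0.
pose t := c * X * V n.
have t0 : 0 < t by rewrite /t mulr_gt0.
have KH (v : 'rV[R]_n) : deviation_ball r.+1 c0 (c * X) (4 * t) v ->
    huber_sum v <= 4 * t / c0 /\ trend_variation r.+1 v <= 4 * V n.
  rewrite /deviation_ball /= => Kv.
  have h1 := huber_sum_ge0 v; have h2 := @trend_variation_ge0 R r.+1 n v.
  split.
    rewrite ler_pdivlMr // mulrC; have := mulr_ge0 (ltW lam0) h2; lra.
  rewrite -(ler_pM2l lam0); have := mulr_ge0 (ltW c00) h1.
  by move: Kv; rewrite /t; lra.
have Xsmall : 4 * t / c0 < (n %/ (2 * r.+1))%:R.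
  have := leq_double_divn (isT : (0 < 2 * r.+1)%N) nr.
  rewrite -(ler_nat R) 2!natrM; set h := (n %/ _)%:R => nh.
  have e2 : eta <= c0 / (32 * r.+1%:R * c * V2) by rewrite /eta ge_min lexx orbT.
  have X2 : X <= c0 / (32 * r.+1%:R * c * V2) * n%:R.
    by apply: le_trans Xeta _; rewrite ler_pM2r.
  rewrite ltr_pdivrMr //.
  have t2 : 4 * t <= 4 * (c * (c0 / (32 * r.+1%:R * c * V2) * n%:R) * V2).
    rewrite ler_pM2l // /t; apply: ler_pM => //; first exact: ltW.
    by rewrite ler_pM2l.
  apply: le_lt_trans t2 _.
  have -> : 4 * (c * (c0 / (32 * r.+1%:R * c * V2) * n%:R) * V2) =
     c0 * (n%:R / (8 * r.+1%:R)).
    by field; rewrite !gt_eqF.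
  rewrite [ltRHS]mulrC ltr_pM2l // ltr_pdivrMr ?mulr_gt0 //.
  move: nh; rewrite natrM => nh; nra.
have supK (v : 'rV[R]_n) : deviation_ball r.+1 c0 (c * X) (4 * t) v ->
    forall i, `|v 0 i| <= C.
  move=> /KH[h1 h2]; apply: sup_bound => //.
    by apply: le_trans h2 _; rewrite ler_pM2l.
  exact: le_lt_trans h1 Xsmall.
have width (S : finType) (s0 : S) (x : S -> 'rV[R]_n) :
   (forall s, deviation_ball r.+1 c0 (c * X) (4 * t) (x s)) ->
   Eprod (@rademacher R _) (fun e => fmax s0 (fun s =>
        \sum_i sgn R (e i) * x s 0 i)) <= eps * t.
  move=> Kx.
  have XE' : X ^+ (2 * r).+3 = n%:R * ln n%:R.
    by rewrite -XE mulnS addn1.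
  have V40 : 0 <= 4 * V n by rewrite mulr_ge0 // ltW.
  apply: le_trans (@trend_width R S s0 r n x X (4 * V n) (C * (4 * t / c0)) a
    r_n ln1 X1 Xn XE' V40 a0 (fun s => (KH _ (Kx s)).2) _) _.
    move=> s; apply: le_trans (huber_sum_sq C1 (supK _ (Kx s))) _.
    by rewrite ler_pM2l // (KH _ (Kx s)).1.
  have cA : 48 * r.+1%:R * C / (eps ^+ 2 * c0 * V1) <= c by rewrite /c1 in cc1; lra.
  have cB : 40 / eps <= c by rewrite /c1 in cc1; lra.
  have e1 : 2^-1 * (a * (C * (4 * t / c0))) = eps * t / 4.
    by rewrite /a; field; rewrite !gt_eqF.
  have e2 : 2^-1 * (a^-1 * (3 * r.+1%:R * X)) <= eps * t / 4.
    rewrite /a (_ : 2^-1 * ((eps * c0 / (8 * C))^-1 * (3 * r.+1%:R * X)) =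
      48 * r.+1%:R * C / (eps ^+ 2 * c0 * V1) * (eps * X * V1 / 4)); last first.
      by field; rewrite !gt_eqF.
    have p1 : 0 <= eps * X * V1 / 4.
      by apply: ltW; rewrite divr_gt0 // !mulr_gt0.
    apply: le_trans (ler_wpM2r p1 cA) _.
    have p2 : 0 <= eps * c * X by apply: ltW; rewrite !mulr_gt0.
    have := ler_wpM2l p2 VV1; rewrite /t; lra.
  have e3 : 5 * (4 * V n) * X <= eps * t / 2.
    rewrite (_ : 5 * (4 * V n) * X = 40 / eps * (eps * V n * X / 2)); last first.
      by field; rewrite gt_eqF.
    have p1 : 0 <= eps * V n * X / 2 by apply: ltW; rewrite divr_gt0 // !mulr_gt0.
    by apply: le_trans (ler_wpM2r p1 cB) _; rewrite /t; lra.
  rewrite mulrDr e1; lra.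
have [B [mB badB PB]] := large_deviation_bound htau hL hf eps0 n_pos (ltW C0)
  lam0 tvV erefl t0 indep hcdf growth est supK width.
have mG := measurable_delta_sq theta_hat theta (4 * c * V2 / c0 * (X / n%:R)).
(* Outside [B] the Huber sum is at most [4 * t / c0], where [t <= c * X * V2]; division by [n] gives
   the claimed rate. *)
apply: (@le_trans _ _ (P (~` B))).
  by rewrite probability_setC // EFinB leeB.
apply: le_measure; rewrite ?inE //; first exact: measurableC.
move=> w /= nB; rewrite leNgt; apply/negP => lt; apply: nB; apply: badB => /=.
move: lt; rewrite /delta_sq -/(huber_sum _).
move: (huber_sum _) => H; rewrite mulrA -[_ / n%:R]mulrC
  ltr_pM2l ?invr_gt0 // => lt.
have : 4 * c * V2 * X < c0 * H.
  rewrite (_ : 4 * c * V2 * X = c0 * (4 * c * V2 / c0 * X)); last first.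
    by field; rewrite gt_eqF.
  by rewrite ltr_pM2l.
apply: le_lt_trans; rewrite /t.
have := ler_wpM2l (ltW lam0) VV2; lra.
Qed.
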